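(* Consider the control problem with cost $J(\pi,\rho)$ described in the context, and let a prior $\rho=\{\rho_k\}_{k=0}^{T-1}$ be given with $\rho_k=\mathcal{N}(\mu_{\rho_k},\Sigma_{\rho_k})$, $\mu_{\rho_k}\in\mathbb{R}^m$, $\Sigma_{\rho_k}\succ 0$. Assume that $A_k$ is invertible for all $k\in\{0,\dots,T-1\}$. Let $\{\Pi_k\}_{k=0}^T$ be the unique solution of $$\Pi_k = A_k^\top \Pi_{k+1}A_k - A_k^\top \Pi_{k+1}B_k\left\{R_k+B_k^\top\Pi_{k+1}B_k+\varepsilon\Sigma_{\rho_k}^{-1}\right\}^{-1}B_k^\top\Pi_{k+1}A_k,\quad k\in\{0,\dots,T-1\},\qquad \Pi_T=F$$ (under the invertibility assumption all $\Pi_k$ are positive definite), and let $\{r_k\}_{k=0}^T$ be given by $$r_k = A_k^{-1}r_{k+1}-\varepsilon\,\Pi_k^{-1}A_k^\top\Pi_{k+1}B_k\left\{\Sigma_{\rho_k}(R_k+B_k^\top\Pi_{k+1}B_k)+\varepsilon I\right\}^{-1}\mu_{\rho_k},\quad k\in\{0,\dots,T-1\},\qquad r_T=\mu_{x_{\mathrm{fin}}}.$$ For $k\in\{0,\dots,T-1\}$ and $x\in\mathbb{R}^n$ put $$\mu_{Q_k}(x) := -(R_k+B_k^\top\Pi_{k+1}B_k)^{-1}B_k^\top\Pi_{k+1}A_k\,(x-A_k^{-1}r_{k+1}),\qquad \Sigma_{Q_k}:=\varepsilon(R_k+B_k^\top\Pi_{k+1}B_k)^{-1}.$$ Then the minimization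 of $\pi\mapsto J(\pi,\rho)$ over all stochastic policies $\pi=\{\pi_k\}_{k=0}^{T-1}$, with $\rho$ fixed to the given prior, has a unique optimal policy $\pi^\rho=\{\pi_k^\rho\}_{k=0}^{T-1}$, and it is given by $$\pi_k^\rho(u\mid x)\propto \rho_k(u)\,\mathcal{N}(u\mid\mu_{Q_k}(x),\Sigma_{Q_k}),\quad k\in\{0,\dots,T-1\},$$ where $\propto$ means proportionality as probability densities in $u\in\mathbb{R}^m$ for each $x$.
   Context: Setting. $\varepsilon>0$; $T\ge1$, $n,m\ge 1$ are integers; $\mu_{x_{\mathrm{ini}}},\mu_{x_{\mathrm{fin}}}\in\mathbb{R}^n$; $A_k\in\mathbb{R}^{n\times n}$, $B_k\in\mathbb{R}^{n\times m}$; $R_k\in\mathbb{R}^{m\times m}$, $F,\Sigma_{w_k},\Sigma_{x_{\mathrm{ini}}}\in\mathbb{R}^{n\times n}$ are all symmetric positive definite ($\succ0$), for $k\in\{0,\dots,T-1\}$. A (stochastic) policy is a family $\pi=\{\pi_k\}_{k=0}^{T-1}$, where $\pi_k(\cdot\mid x)$ is a conditional probability distribution (Markov kernel) on $\mathbb{R}^m$ given $x\in\mathbb{R}^n$. A prior is a family $\rho=\{\rho_k\}_{k=0}^{T-1}$ of probability distributions on $\mathbb{R}^m$. Under a policy $\pi$, the state $x_k\in\mathbb{R}^n$ and input $u_k\in\mathbb{R}^m$ evolve by $$x_{k+1}=A_kx_k+B_ku_k+w_k,\quad u_k\sim\pi_k(\cdot\mid x)\text{ given }x=x_k,\quad w_k\sim\mathcal{N}(0,\Sigma_{w_k}),\quad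 x_0\sim\mathcal{N}(\mu_{x_{\mathrm{ini}}},\Sigma_{x_{\mathrm{ini}}}),$$ where, for each $k$, the conditional law of $u_k$ given the whole past $(x_0,u_0,w_0,\dots,u_{k-1},w_{k-1},x_k)$ is $\pi_k(\cdot\mid x_k)$, and $w_k$ is independent of $(x_0,u_0,w_0,\dots,u_{k-1},w_{k-1},x_k,u_k)$. The cost is $$J(\pi,\rho):=\mathbb{E}\left[\sum_{k=0}^{T-1}\left\{\tfrac12\|u_k\|_{R_k}^2+\varepsilon\,\mathcal{D}_{\mathrm{KL}}[\pi_k(\cdot\mid x_k)\,\|\,\rho_k(\cdot)]\right\}+\tfrac12\|x_T-\mu_{x_{\mathrm{fin}}}\|_F^2\right],$$ with values in $[0,\infty]$, where $\|v\|_M:=(v^\top Mv)^{1/2}$ and $\mathcal{D}_{\mathrm{KL}}[p\|q]$ is the Kullback–Leibler divergence ($+\infty$ if $p$ is not absolutely continuous with respect to $q$). $\mathcal{N}(\mu,\Sigma)$ is the Gaussian distribution with mean $\mu$ and covariance $\Sigma$, and $\mathcal{N}(u\mid\mu,\Sigma)$ is its density at $u$; the same symbol is used for a distribution and its density. Policies are identified when $\pi_k(\cdot\mid x)$ coincide as measures for Lebesgue-almost every $x$, for every $k$ (the law of each $x_k$ is equivalent to Lebesgue measure). *)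

(* Defs.v *)
From HB Require Import structures.
From mathcomp Require Import all_boot all_order all_algebra.
From mathcomp Require Import all_classical all_reals all_analysis.
From mathcomp Require Import measurable_realfun ring.
Set Implicit Arguments.
Unset Strict Implicit.
Unset Printing Implicit Defensive.
Import Order.TTheory GRing.Theory Num.Theory.
Import numFieldNormedType.Exports.
Local Open Scope charge_scope.
Local Open Scope classical_set_scope.
Local Open Scope ring_scope.

Definition measure_matrix_display : measure_display -> measure_display.
Proof. exact. Qed.

(* The sigma-algebra on matrices is the one generated by the entries, i.e. the
   Borel one for real matrices. *)
Section measurable_matrix.
Context {d} {T : measurableType d} (m n : nat).

Let coors (k : 'I_(m * n)) (M : 'M[T]_(m, n)) : T := mxvec M 0 k.

Let mx0 : g_sigma_preimage coors set0.
Proof. exact: sigma_algebra0. Qed.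

Let mxC A : g_sigma_preimage coors A -> g_sigma_preimage coors (~` A).
Proof. exact: sigma_algebraC. Qed.

Let mxU (F : _^nat) : (forall i, g_sigma_preimage coors (F i)) ->
  g_sigma_preimage coors (\bigcup_i (F i)).
Proof. exact: sigma_algebra_bigcup. Qed.

HB.instance Definition _ := @isMeasurable.Build (measure_matrix_display d)
  'M[T]_(m, n) (g_sigma_preimage coors) mx0 mxC mxU.

Lemma measurable_mxvec k :
  measurable_fun [set: 'M[T]_(m, n)] (fun M => mxvec M 0 k).
Proof.
move=> _ Y mY; rewrite setTI; apply: sub_sigma_algebra => /=.
rewrite -bigcup_seq/=; exists k => /=; first by rewrite mem_index_enum.
by exists Y => //; rewrite setTI.
Qed.

Lemma measurable_coord i j :
  measurable_fun [set: 'M[T]_(m, n)] (fun M => M i j).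
Proof.
rewrite (_ : (fun _ => _) = (fun M => mxvec M 0 (mxvec_index i j))).
  exact: measurable_mxvec.
by apply/funext => M; rewrite mxvecE.
Qed.

Lemma measurable_fun_mxP d1 (X : measurableType d1) (f : X -> 'M[T]_(m, n)) :
  (forall i j, measurable_fun [set: X] (fun x => f x i j)) ->
  measurable_fun [set: X] f.
Proof.
move=> mf.
suff prefS : g_sigma_preimage (fun k => coors k \o f) `<=` measurable.
  move=> _ A mA; rewrite setTI; apply: prefS.
  by rewrite g_sigma_preimage_comp; exists A => //; rewrite setTI.
apply: smallest_sub; first exact: sigma_algebra_measurable.
move=> A; rewrite -bigcup_seq/= => -[k _ [B mB <-]].
case/mxvec_indexP: k => i j.
rewrite [X in _ `&` X](_ : _ = (fun x => f x i j) @^-1` B); last first.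
  by apply/funext => x; rewrite /preimage/= /coors mxvecE.
exact: mf.
Qed.

End measurable_matrix.

Section lebesgue.
Context {R : realType}.

Definition vcons n (p : measurableTypeR R * 'cV[R]_n) : 'cV[R]_n.+1 :=
  col_mx (const_mx p.1 : 'cV[R]_1) p.2 : 'cV[R]_(1 + n).

Lemma vcons0 n p : vcons p (ord0 : 'I_n.+1) 0 = p.1.
Proof.
have e : (ord0 : 'I_n.+1) = lshift n (ord0 : 'I_1) by exact/val_inj.
by rewrite e; apply: etrans (col_mxEu _ _ (ord0 : 'I_1) 0) _; rewrite mxE.
Qed.

Lemma vconsS n p i : vcons p (lift ord0 i : 'I_n.+1) 0 = p.2 i 0.
Proof.
have e : (lift ord0 i : 'I_n.+1) = rshift 1 i by exact/val_inj.
by rewrite e; apply: etrans (col_mxEd _ _ _ _) _.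
Qed.

Lemma measurable_vcons n : measurable_fun setT (@vcons n).
Proof.
apply: measurable_fun_mxP => i j; rewrite ord1.
have [k ->|->] := unliftP ord0 i.
  under eq_fun do rewrite vconsS.
  apply: (@measurableT_comp _ _ _ _ _ _ (fun v : 'cV[R]_n => v k 0)) => //.
  exact: measurable_coord.
under eq_fun do rewrite vcons0.
exact: measurable_fst.
Qed.

HB.instance Definition _ n :=
  isMeasurableFun.Build _ _ _ _ (@vcons n) (@measurable_vcons n).

Definition vuncons n (v : 'cV[R]_n.+1) : measurableTypeR R * 'cV[R]_n :=
  (v 0 0, \col_i v (lift ord0 i) 0).

Lemma measurable_vuncons n : measurable_fun setT (@vuncons n).
Proof.
apply/measurable_fun_pairP; split; first exact: measurable_coord.
apply: measurable_fun_mxP => i j /=.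
under eq_fun do rewrite mxE.
exact: measurable_coord.
Qed.

Lemma vconsK n : cancel (@vcons n) (@vuncons n).
Proof.
case=> x v; rewrite /vuncons vcons0; congr pair.
by apply/colP => i; rewrite mxE vconsS.
Qed.

Lemma vunconsK n : cancel (@vuncons n) (@vcons n).
Proof.
move=> v; apply/colP => i.
by have [k ->|->] := unliftP ord0 i; rewrite ?vconsS ?vcons0 ?mxE.
Qed.

Section lebesgue_cons.
Variables (n : nat) (mu : {sigma_finite_measure set 'cV[R]_n -> \bar R}).

Definition lebesgue_cons : set 'cV[R]_n.+1 -> \bar R :=
  pushforward (@lebesgue_measure R \x mu)%E (@vcons n).

Let lebesgue_cons0 : lebesgue_cons set0 = 0%E.
Proof. by rewrite /lebesgue_cons /pushforward preimage_set0 measure0. Qed.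

Let lebesgue_cons_ge0 A : (0 <= lebesgue_cons A)%E.
Proof. exact: measure_ge0. Qed.

Let lebesgue_cons_sigma_additive : semi_sigma_additive lebesgue_cons.
Proof.
exact: measure_semi_sigma_additive.
Qed.

HB.instance Definition _ := isMeasure.Build _ _ _ lebesgue_cons
  lebesgue_cons0 lebesgue_cons_ge0 lebesgue_cons_sigma_additive.

Let lebesgue_cons_sigma_finite : sigma_finite setT lebesgue_cons.
Proof.
have /sigma_finiteP[F [TF ndF Foo]] := sigma_finiteT (@lebesgue_measure R).
have /sigma_finiteP[G [TG ndG Goo]] := sigma_finiteT mu.
exists (fun k => @vuncons n @^-1` (F k `*` G k)).
  rewrite -preimage_bigcup -[LHS](preimage_setT (@vuncons n)); congr preimage.
  rewrite -setXTT TF TG predeqE => -[x y]; split.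
    move=> [/= [i _ Fix] [j _ Gjy]]; exists (maxn i j) => //; split.
    - by move: x Fix; exact/subsetPset/ndF/leq_maxl.
    - by move: y Gjy; exact/subsetPset/ndG/leq_maxr.
  by move=> [i _ []/= ? ?]; split; exists i.
move=> k; have [mF Fk] := Foo k; have [mG Gk] := Goo k; split.
  rewrite -[X in measurable X]setTI; apply: measurable_vuncons => //.
  exact: measurableX.
rewrite /lebesgue_cons /pushforward -comp_preimage.
rewrite (_ : _ \o _ = id); last by apply/funext => x; exact: vconsK.
by rewrite preimage_id product_measure1E// lte_mul_pinfty// ge0_fin_numE.
Qed.

HB.instance Definition _ := @Measure_isSigmaFinite.Build _ _ _ lebesgue_cons
  lebesgue_cons_sigma_finite.

End lebesgue_cons.

(* n-dimensional Lebesgue measure as the n-fold product; 'cV[R]_n.+1 is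
   identified with R * 'cV[R]_n by vcons. *)
Fixpoint lebesgue_cV n : {sigma_finite_measure set 'cV[R]_n -> \bar R} :=
  match n with
  | 0 => dirac (0 : 'cV[R]_0)
  | n'.+1 => lebesgue_cons (lebesgue_cV n')
  end.

End lebesgue.

Section quadratic_forms.
Context {R : realType}.

Definition qform n (S : 'M[R]_n) (v : 'cV[R]_n) : R := (v^T *m S *m v) 0 0.

Definition posdefmx n (S : 'M[R]_n) : Prop :=
  S^T = S /\ forall v : 'cV[R]_n, v != 0 -> 0 < qform S v.

Lemma posdefmx_qform_ge0 n (S : 'M[R]_n) v : posdefmx S -> 0 <= qform S v.
Proof.
case=> _ S0; have [->|/S0/ltW//] := eqVneq v 0.
by rewrite /qform mulmx0 mxE.
Qed.

Lemma posdefmx1 n : posdefmx (1%:M : 'M[R]_n).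
Proof.
split=> [|v v0]; first exact: trmx1.
rewrite /qform mulmx1 mxE; under eq_bigr do rewrite mxE -expr2.
rewrite lt0r sumr_ge0 ?andbT; last by move=> i _; exact: sqr_ge0.
apply: contra v0 => /eqP/psumr_eq0P v0; apply/eqP/colP => i; rewrite mxE.
by apply/eqP; rewrite -sqrf_eq0 v0// => j _; exact: sqr_ge0.
Qed.

Lemma posdefmx_unit n (S : 'M[R]_n) : posdefmx S -> S \in unitmx.
Proof.
case=> tS S0; rewrite -row_free_unit -kermx_eq0.
apply/negP => /negP/rowV0Pn[v /sub_kermxP vS v0].
have /S0 : v^T != 0 by rewrite -trmx0 (inj_eq trmx_inj).
by rewrite /qform trmxK vS mul0mx mxE ltxx.
Qed.

Lemma posdefmx_inv n (S : 'M[R]_n) : posdefmx S -> posdefmx (invmx S).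
Proof.
move=> pS; have uS := posdefmx_unit pS; case: pS => tS S0; split.
  by rewrite trmx_inv tS.
move=> v v0; have /S0 : invmx S *m v != 0.
  apply: contra v0 => /eqP Sv.
  by rewrite -(mul1mx v) -(mulmxV uS) -mulmxA Sv mulmx0.
by rewrite /qform trmx_mul trmx_inv tS -mulmxA !mulmxA mulmxKV.
Qed.

Lemma measurable_qform n (S : 'M[R]_n) :
  measurable_fun [set: 'cV[R]_n] (qform S).
Proof.
rewrite (_ : qform S =
    fun v => \sum_j (\sum_i v i 0 * S i j) * v j 0); last first.
  apply/funext => v; rewrite /qform mxE; apply: eq_bigr => j _.
  by rewrite mxE; congr *%R; apply: eq_bigr => i _; rewrite mxE.
apply: measurable_sum => j.
apply: measurable_funM; last exact: measurable_coord.
apply: measurable_sum => i; apply: measurable_funM; last exact: measurable_cst.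
exact: measurable_coord.
Qed.

Lemma qform_schur n (a : R) (q : 'cV[R]_n) (D : 'M[R]_n) (x : R) y : a != 0 ->
  qform (block_mx (a%:M : 'M[R]_1) q^T q D)
        (col_mx (x%:M : 'cV[R]_1) y) =
  a * (x + a^-1 * (q^T *m y) 0 0) ^+ 2 + qform (D - a^-1 *: (q *m q^T)) y.
Proof.
move=> a0; rewrite /qform tr_col_mx mul_row_block mul_row_col.
rewrite tr_scalar_mx mulmxBr mulmxBl -scalemxAr -scalemxAl !mulmxA.
have e1 : q^T *m y = ((q^T *m y) 0 0)%:M by rewrite -mx11_scalar.
have e2 : y^T *m q = ((q^T *m y) 0 0)%:M.
  by rewrite -(trmxK q) -trmx_mul e1 tr_scalar_mx !trmxK -mx11_scalar.
rewrite -(mulmxA (y^T *m q)) !mulmxDl -(mulmxA x%:M q^T) e2 e1.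
set s := (q^T *m y) 0 0; rewrite -!scalar_mxM.
set M := y^T *m D *m y.
have trE (A B : 'M[R]_1) : (A + B) 0 0 = A 0 0 + B 0 0 by rewrite mxE.
have nE (A : 'M[R]_1) : (- A) 0 0 = - A 0 0 by rewrite mxE.
have zE c (A : 'M[R]_1) : (c *: A) 0 0 = c * A 0 0 by rewrite mxE.
have sE (c : R) : (c%:M : 'M[R]_1) 0 0 = c by rewrite mxE mulr1n.
by rewrite !(trE, nE, zE, sE); field; exact: a0.
Qed.

Lemma vcons_col_mx n (x : R) (y : 'cV[R]_n) :
  vcons (x, y) = col_mx (x%:M : 'cV[R]_1) y.
Proof.
rewrite /vcons (_ : const_mx _ = x%:M)//.
by apply/matrixP => i j; rewrite !mxE !ord1.
Qed.

Lemma posdefmx_block n (P : 'M[R]_n.+1) : posdefmx P ->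
  exists a (q : 'cV[R]_n) (S : 'M[R]_n),
    [/\ 0 < a, posdefmx S, \det P = a * \det S &
     forall x y, qform P (vcons (x, y)) =
       a * (x + a^-1 * (q^T *m y) 0 0) ^+ 2 + qform S y].
Proof.
move=> pP; pose P' : 'M[R]_(1 + n) := P.
pose a := P' 0 0; pose q := dlsubmx P'; pose D := drsubmx P'.
have PE : P' = block_mx (a%:M : 'M[R]_1) q^T q D.
  rewrite -[LHS]submxK; congr block_mx.
    rewrite [LHS]mx11_scalar; congr _%:M; rewrite !mxE.
    by congr (P' _ _); exact/val_inj.
  by rewrite /q trmx_dlsub; congr ursubmx; exact: esym (proj1 pP).
have v0 x (y : 'cV[R]_n) : vcons (x, y) = 0 -> y = 0 /\ x = 0.
  move=> xy; split; last by have := vcons0 (x, y); rewrite xy mxE.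
  by apply/colP => i; have := vconsS (x, y) i; rewrite xy !mxE.
have aE : qform (block_mx (a%:M : 'M[R]_1) q^T q D)
                (col_mx (1%:M : 'cV[R]_1) 0) = a.
  rewrite /qform tr_col_mx mul_row_block mul_row_col.
  by rewrite trmx0 !mul0mx mulmx0 !addr0 trmx1 mul1mx mulmx1 mxE mulr1n.
have a0 : 0 < a.
  have /(proj2 pP) : vcons (1 : R, 0 : 'cV[R]_n) != 0.
    by apply/eqP => /v0[_ /eqP]; rewrite oner_eq0.
  by rewrite vcons_col_mx -[P]/P' PE aE.
pose S := D - a^-1 *: (q *m q^T).
have SE x y : qform P (vcons (x, y)) =
    a * (x + a^-1 * (q^T *m y) 0 0) ^+ 2 + qform S y.
  by rewrite vcons_col_mx -[P]/P' PE qform_schur// gt_eqF.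
exists a, q, S; split => //.
  split.
    rewrite /S linearB/= linearZ/= trmx_mul trmxK; congr (_ - _).
    by rewrite /D trmx_drsub; congr drsubmx; exact: (proj1 pP).
  move=> y y0; pose x := - (a^-1 * (q^T *m y) 0 0).
  have /(proj2 pP) : vcons (x, y) != 0 by apply: contra y0 => /eqP/v0[-> _].
  by rewrite SE /x addNr expr0n/= mulr0 add0r.
have PSE : block_mx (a%:M : 'M[R]_1) q^T q D =
    block_mx (1%:M : 'M[R]_1) 0 (a^-1 *: q) 1%:M *m
    block_mx (a%:M : 'M[R]_1) q^T 0 S.
  rewrite mulmx_block !mul1mx !mul0mx !addr0; congr block_mx.
    by rewrite mul_mx_scalar scalerA divff ?scale1r// gt_eqF.
  by rewrite /S -scalemxAl addrC subrK.
have dE : \det (block_mx (a%:M : 'M[R]_1) q^T q D) = a * \det S.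
  by rewrite PSE det_mulmx det_lblock det_ublock !det1 !mul1r det_scalar1.
by rewrite -[P]/P' PE dE.
Qed.

End quadratic_forms.

Section gaussian.
Context {R : realType}.

Lemma integral_expR_sqr (a m : R) : 0 < a ->
  (\int[lebesgue_measure]_x (expR (- (a * (x - m) ^+ 2) / 2))%:E =
   (Num.sqrt (2 * pi / a))%:E)%E.
Proof.
move=> a0; pose s := Num.sqrt a^-1.
have s0 : s != 0 by rewrite gt_eqF// sqrtr_gt0 invr_gt0.
have s2 : s ^+ 2 = a^-1 by rewrite sqr_sqrtr// invr_ge0 ltW.
transitivity (\int[lebesgue_measure]_x
    (Num.sqrt (2 * pi / a) * normal_pdf m s x)%:E)%E.
  apply: eq_integral => x _; congr EFin.
  rewrite normal_pdfE// /normal_peak s2.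
  rewrite (_ : a^-1 * pi *+ 2 = 2 * pi / a); last first.
    by rewrite -mulr_natl mulrCA mulrC.
  rewrite mulVKf; last first.
    by rewrite gt_eqF// sqrtr_gt0 divr_gt0// mulr_gt0// pi_gt0.
  by rewrite /normal_fun s2; congr expR; field; rewrite gt_eqF.
under eq_integral do rewrite EFinM.
rewrite integralZl//; last exact: integrable_normal_pdf.
by rewrite integral_normal_pdf mule1.
Qed.

Lemma measurable_qform_sub n (S : 'M[R]_n) (mu : 'cV[R]_n) :
  measurable_fun [set: 'cV[R]_n] (fun u => qform S (u - mu)).
Proof.
apply: measurableT_comp; first exact: measurable_qform.
apply: measurable_fun_mxP => i j.
under eq_fun do rewrite !mxE.
apply: measurable_funB; [exact: measurable_coord|exact: measurable_cst].
Qed.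

Lemma measurable_expR_qform n (S : 'M[R]_n) (mu : 'cV[R]_n) :
  measurable_fun [set: 'cV[R]_n] (fun u => expR (- qform S (u - mu) / 2)).
Proof.
apply: measurableT_comp => //; apply: measurable_funM => //.
apply: measurableT_comp => //; exact: measurable_qform_sub.
Qed.

Lemma integral_expR_qform n (S : 'M[R]_n) (mu : 'cV[R]_n) : posdefmx S ->
  0 < \det S /\
  (\int[lebesgue_cV n]_u (expR (- qform S (u - mu) / 2))%:E =
   (Num.sqrt ((2 * pi) ^+ n / \det S))%:E)%E.
Proof.
elim: n => [|n ih] in S mu * => pS.
  rewrite det_mx00; split => //=.
  rewrite integral_dirac//=; last first.
    by apply/measurable_EFinP; exact: measurable_expR_qform.
  rewrite diracT mul1e expr0 divr1 sqrtr1; congr EFin.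
  by rewrite /qform mxE big_ord0 oppr0 mul0r expR0.
have [a [q [S' [a0 pS' detS SE]]]] := posdefmx_block pS.
pose b := vuncons mu; have muE : mu = vcons b by rewrite vunconsK.
have [dS' ihS'] := ih S' b.2 pS'.
have dS : 0 < \det S by rewrite detS mulr_gt0.
split => //=.
have mf : measurable_fun [set: 'cV[R]_n.+1]
    (fun u => (expR (- qform S (u - mu) / 2))%:E).
  by apply/measurable_EFinP; exact: measurable_expR_qform.
rewrite /lebesgue_cons ge0_integral_pushforward//.
rewrite preimage_setT fubini_tonelli2/=; last 2 first.
- by apply: measurableT_comp => //; exact: measurable_vcons.
- by move=> u; rewrite lee_fin expR_ge0.
have addE (u v : 'cV[R]_n.+1) i : (u - v) i 0 = u i 0 - v i 0.
  by rewrite !mxE.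
have subE x y : vcons (x, y) - mu = vcons (x - b.1, y - b.2).
  rewrite [in LHS]muE; apply/colP => i; rewrite addE.
  by have [k ->|->] := unliftP ord0 i; rewrite ?vconsS ?vcons0//= !mxE.
transitivity (\int[lebesgue_cV n]_y ((Num.sqrt (2 * pi / a))%:E *
    (expR (- qform S' (y - b.2) / 2))%:E))%E.
  apply: eq_integral => y _; rewrite /fubini_G/=.
  pose c := b.1 - a^-1 * (q^T *m (y - b.2)) 0 0.
  under eq_integral => x _.
    rewrite subE SE (_ : - _ / 2 = - (a * (x - c) ^+ 2) / 2 +
      - qform S' (y - b.2) / 2).
      rewrite expRD EFinM muleC.
      over.
    by rewrite /c -mulrDl opprD; congr ((- (_ * _ ^+ 2) + _) / _); ring.
  rewrite ge0_integralZl//.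
  - by rewrite integral_expR_sqr// muleC.
  - apply/measurable_EFinP; apply: measurableT_comp => //.
    apply: measurable_funM => //; apply: measurableT_comp => //.
    apply: measurable_funM => //; apply: measurable_funX => //.
    exact: measurable_funB.
rewrite ge0_integralZl//.
- rewrite ihS' -EFinM -sqrtrM; last by rewrite divr_ge0 ?mulr_ge0 ?pi_ge0// ltW.
  by rewrite detS exprS; congr (Num.sqrt _)%:E; field; rewrite !gt_eqF.
- by apply/measurable_EFinP; exact: measurable_expR_qform.

Qed.

(* A matrix Sigma that is not positive definite is replaced by the identity, so
   that gaussian mu Sigma is a probability for all Sigma. *)
Definition gaussian_pdf n (mu : 'cV[R]_n) (Sigma : 'M[R]_n)
    (u : 'cV[R]_n) : R :=
  let S := if `[< posdefmx Sigma >] then Sigma else 1%:M in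
  expR (- qform (invmx S) (u - mu) / 2) / Num.sqrt ((2 * pi) ^+ n * \det S).

Section gaussian_prob.
Variables (n : nat) (mu : 'cV[R]_n) (Sigma : 'M[R]_n).

Lemma gaussian_pdf_ge0 u : 0 <= gaussian_pdf mu Sigma u.
Proof. by rewrite mulr_ge0 ?expR_ge0// invr_ge0. Qed.

Lemma measurable_gaussian_pdf :
  measurable_fun [set: 'cV[R]_n] (gaussian_pdf mu Sigma).
Proof. by apply: measurable_funM => //; exact: measurable_expR_qform. Qed.

Lemma integral_gaussian_pdf :
  (\int[lebesgue_cV n]_u (gaussian_pdf mu Sigma u)%:E = 1)%E.
Proof.
rewrite /gaussian_pdf; set S := if _ then _ else _.
have pS : posdefmx S by rewrite /S; case: asboolP => // _; exact: posdefmx1.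
have [dS intS] := integral_expR_qform mu (posdefmx_inv pS).
under eq_integral do rewrite mulrC EFinM.
rewrite ge0_integralZl//.
- rewrite intS -EFinM det_inv invrK mulVf// gt_eqF// sqrtr_gt0.
  rewrite mulr_gt0//; first by rewrite exprn_gt0// mulr_gt0// pi_gt0.
  by rewrite -invr_gt0 -det_inv.
- by apply/measurable_EFinP; exact: measurable_expR_qform.
Qed.

Definition gaussian : set 'cV[R]_n -> \bar R :=
  fun A => (\int[lebesgue_cV n]_(u in A) (gaussian_pdf mu Sigma u)%:E)%E.

Let gaussian0 : gaussian set0 = 0%E.
Proof. by rewrite /gaussian integral_set0. Qed.

Let gaussian_ge0 A : (0 <= gaussian A)%E.
Proof. by apply: integral_ge0 => u _; rewrite lee_fin gaussian_pdf_ge0. Qed.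

Let gaussian_sigma_additive : semi_sigma_additive gaussian.
Proof.
move=> A mA tA mUA; rewrite /gaussian ge0_integral_bigcup//=.
- apply: is_cvg_ereal_nneg_natsum_cond => k _ _.
  by apply: integral_ge0 => u _; rewrite lee_fin gaussian_pdf_ge0.
- apply: measurable_funTS; apply/measurable_EFinP.
  exact: measurable_gaussian_pdf.
- by move=> u _; rewrite lee_fin gaussian_pdf_ge0.
Qed.

HB.instance Definition _ := isMeasure.Build _ _ _ gaussian
  gaussian0 gaussian_ge0 gaussian_sigma_additive.

Let gaussian_setT : gaussian setT = 1%E.
Proof. exact: integral_gaussian_pdf. Qed.

HB.instance Definition _ := Measure_isProbability.Build _ _ R gaussian
  gaussian_setT.

End gaussian_prob.
End gaussian.

Section kernels.
Context {d1 d2 d3} {X : measurableType d1} {Y : measurableType d2}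
  {Z : measurableType d3} {R : realType}.

Section kernel_at.
Variables (K : R.-pker X ~> Y) (x : X).

Definition kernel_at : set Y -> \bar R := K x.

HB.instance Definition _ := Measure.on kernel_at.

Let kernel_at_setT : kernel_at setT = 1%E.
Proof. exact: prob_kernel. Qed.

HB.instance Definition _ := Measure_isProbability.Build _ _ R kernel_at
  kernel_at_setT.

End kernel_at.

Section kernel_comap.
Variables (K : R.-pker Z ~> Y) (f : {mfun X >-> Z}).

Definition kernel_comap (x : X) : {measure set Y -> \bar R} := K (f x).

Let measurable_kernel_comap U :
  measurable U -> measurable_fun [set: X] (kernel_comap ^~ U).
Proof.
by move=> mU; exact: (measurableT_comp (measurable_kernel K _ mU)).
Qed.

HB.instance Definition _ := isKernel.Build _ _ _ _ _ kernel_comap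
  measurable_kernel_comap.

Let kernel_comap_prob x : kernel_comap x setT = 1%E.
Proof. exact: prob_kernel. Qed.

HB.instance Definition _ := Kernel_isProbability.Build _ _ _ _ _ kernel_comap
  kernel_comap_prob.

End kernel_comap.

Section semidirect.
Variables (P : probability X R) (K : R.-pker X ~> Y).

(* Law of (x, y) when x has law P and y has conditional law K x given x. *)
Definition semidirect : set (X * Y) -> \bar R :=
  fun A => (\int[P]_x K x (xsection A x))%E.

Let semidirect0 : semidirect set0 = 0%E.
Proof. by rewrite /semidirect integral0_eq// => x _; rewrite xsection0. Qed.

Let semidirect_ge0 A : (0 <= semidirect A)%E.
Proof. exact: integral_ge0. Qed.

Let semidirect_sigma_additive : semi_sigma_additive semidirect.
Proof.
move=> A mA tA mUA.
rewrite [X in _ --> X](_ : _ = \sum_(i <oo) semidirect (A i))%E.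
  by apply/cvg_closeP; split; [exact: is_cvg_nneseries|rewrite closeE].
rewrite -integral_nneseries//; last first.
  by move=> i; apply: measurable_fun_xsection_finite_kernel; rewrite inE.
apply: eq_integral => x _; apply/esym/cvg_lim => //=; rewrite xsection_bigcup.
apply: (measure_sigma_additive _ (trivIset_xsection tA)) => i.
exact: measurable_xsection.
Qed.

HB.instance Definition _ := isMeasure.Build _ _ _ semidirect
  semidirect0 semidirect_ge0 semidirect_sigma_additive.

Let semidirect_setT : semidirect setT = 1%E.
Proof.
rewrite /semidirect.
under eq_integral do rewrite xsectionE preimage_setT prob_kernel.
by rewrite integral_cst// mul1e; exact: probability_setT.
Qed.

HB.instance Definition _ := Measure_isProbability.Build _ _ R semidirect
  semidirect_setT.

End semidirect.
End kernels.

Definition kl_div d (T : measurableType d) (R : realType)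
    (p q : probability T R) : \bar R :=
  if `[< p `<< q >] then
    (\int[p]_x lne ('d (charge_of_finite_measure p) '/d q x))%E
  else +oo%E.

Section control.
Context {R : realType} (n m : nat).

Definition wnorm p (S : 'M[R]_p) (v : 'cV[R]_p) : R := Num.sqrt (qform S v).

(* Only the indices below the horizon matter, see eq_policy. *)
Definition policy := nat -> R.-pker 'cV[R]_n ~> 'cV[R]_m.

Fixpoint history_display k : measure_display :=
  let dR := measure_matrix_display default_measure_display in
  if k is k'.+1 then
    measure_prod_display (measure_prod_display (history_display k', dR), dR)
  else dR.

(* The elements are (x_0, u_0, w_0, u_1, w_1, ..., u_(k-1), w_(k-1)), nested
   to the left; the current state x_k is a function of them, see state. *)
Fixpoint history k : measurableType (history_display k) :=
  if k is k'.+1 then (history k' * 'cV[R]_m * 'cV[R]_n)%type else 'cV[R]_n.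

Variables (A : nat -> 'M[R]_n) (B : nat -> 'M[R]_(n, m)).

Fixpoint state k : history k -> 'cV[R]_n :=
  if k is k'.+1 then
    fun h => A k' *m state h.1.1 + B k' *m h.1.2 + h.2
  else id.

Lemma measurable_mulmx p q (M : 'M[R]_(p, q)) :
  measurable_fun [set: 'cV[R]_q] (mulmx M).
Proof.
apply: measurable_fun_mxP => i j; under eq_fun do rewrite mxE.
apply: measurable_sum => k; apply: measurable_funM; first exact: measurable_cst.
exact: measurable_coord.
Qed.

Lemma measurable_addmx d (X : measurableType d) p q (f g : X -> 'M[R]_(p, q)) :
  measurable_fun setT f -> measurable_fun setT g ->
  measurable_fun setT (fun x => f x + g x).
Proof.
move=> mf mg; apply: measurable_fun_mxP => i j; under eq_fun do rewrite mxE.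
by apply: measurable_funD; apply: (measurableT_comp (measurable_coord i j)).
Qed.

Lemma measurable_state k : measurable_fun setT (@state k).
Proof.
elim: k => [|k ih] /=; first exact: measurable_id.
apply: measurable_addmx; last exact: measurable_snd.
apply: measurable_addmx; apply: measurableT_comp.
- exact: measurable_mulmx.
- apply: measurableT_comp; first exact: ih.
  exact: (measurableT_comp measurable_fst measurable_fst).
- exact: measurable_mulmx.
- exact: (measurableT_comp measurable_snd measurable_fst).
Qed.

HB.instance Definition _ k :=
  isMeasurableFun.Build _ _ _ _ (@state k) (@measurable_state k).

Variables (mu0 : 'cV[R]_n) (Sigma0 : 'M[R]_n) (Sigmaw : nat -> 'M[R]_n).

(* Canonical law of the history: u_k is drawn from pi_k(. | x_k) conditionally
   on the past, and w_k is independent of the past and of u_k. *)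
Fixpoint history_law (pi : policy) k : probability (history k) R :=
  if k is k'.+1 then
    (semidirect (history_law pi k') (kernel_comap (pi k') (@state k'))
       \x gaussian 0 (Sigmaw k'))%E
  else gaussian mu0 Sigma0.

Variables (eps : R) (Ru : nat -> 'M[R]_m).

Fixpoint running_cost (pi : policy) (rho : nat -> probability 'cV[R]_m R) k :
    history k -> \bar R :=
  if k is k'.+1 then
    fun h => (running_cost pi rho h.1.1 +
      ((wnorm (Ru k') h.1.2 ^+ 2 / 2)%:E +
       eps%:E * kl_div (kernel_at (pi k') (state h.1.1)) (rho k')))%E
  else fun=> 0%E.

Variables (T : nat) (F : 'M[R]_n) (muT : 'cV[R]_n).

Definition cost (pi : policy) (rho : nat -> probability 'cV[R]_m R) : \bar R :=
  (\int[history_law pi T]_h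
     (running_cost pi rho h + (wnorm F (state h - muT) ^+ 2 / 2)%:E))%E.

Definition eq_policy (pi pi' : policy) : Prop :=
  forall k, (k < T)%N -> {ae lebesgue_cV n, forall x, forall U,
    measurable U -> pi k x U = pi' k x U}.

Definition optimal_policy (rho : nat -> probability 'cV[R]_m R)
    (pi : policy) : Prop :=
  forall pi' : policy, (cost pi rho <= cost pi' rho)%E.

Definition riccati (Sigma_rho : nat -> 'M[R]_m) (Pi : nat -> 'M[R]_n) : Prop :=
  Pi T = F /\
  forall k, (k < T)%N ->
    Pi k = (A k)^T *m Pi k.+1 *m A k
      - (A k)^T *m Pi k.+1 *m B k
        *m invmx (Ru k + (B k)^T *m Pi k.+1 *m B k
                  + eps *: invmx (Sigma_rho k))
        *m (B k)^T *m Pi k.+1 *m A k.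

Definition offset_recursion (mu_rho : nat -> 'cV[R]_m)
    (Sigma_rho : nat -> 'M[R]_m) (Pi : nat -> 'M[R]_n)
    (r : nat -> 'cV[R]_n) : Prop :=
  r T = muT /\
  forall k, (k < T)%N ->
    r k = invmx (A k) *m r k.+1
      - eps *: (invmx (Pi k) *m (A k)^T *m Pi k.+1 *m B k
        *m invmx (Sigma_rho k *m (Ru k + (B k)^T *m Pi k.+1 *m B k) + eps%:M)
        *m mu_rho k).

Definition mean_Q (Pi : nat -> 'M[R]_n) (r : nat -> 'cV[R]_n) k
    (x : 'cV[R]_n) : 'cV[R]_m :=
  - (invmx (Ru k + (B k)^T *m Pi k.+1 *m B k) *m (B k)^T *m Pi k.+1 *m A k
     *m (x - invmx (A k) *m r k.+1)).

Definition cov_Q (Pi : nat -> 'M[R]_n) k : 'M[R]_m :=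
  eps *: invmx (Ru k + (B k)^T *m Pi k.+1 *m B k).

End control.

Definition density_propto (R : realType) p (P : set 'cV[R]_p -> \bar R)
    (g : 'cV[R]_p -> R) : Prop :=
  exists2 c : R, 0 < c & forall U, measurable U ->
    P U = (\int[lebesgue_cV p]_(u in U) (c * g u)%:E)%E.

(* Main.v *)
Require Import Defs.
From HB Require Import structures.
From mathcomp Require Import all_boot all_order all_algebra.
From mathcomp Require Import all_classical all_reals all_analysis.
From mathcomp Require Import measurable_realfun ring lra.
Set Implicit Arguments.
Unset Strict Implicit.
Unset Printing Implicit Defensive.
Import Order.TTheory GRing.Theory Num.Theory.
Import numFieldNormedType.Exports.
Local Open Scope classical_set_scope.
Local Open Scope ring_scope.

(* Dynamic programming with Gibbs' variational principle at every stage.  If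
   [V_{k+1}] is a quadratic value function and [c_x u] is the input cost plus the
   expectation of [V_{k+1}] at the next state, then [E_p c_x + eps KL(p || rho_k)]
   is minimised over [p] by [q_x = exp ((v(x) - c_x) / eps) rho_k], with minimum
   [v(x)].  Completing the square shows that [q_x] is the Gaussian proportional to
   [rho_k N(mu_Q(x), Sigma_Q)] and that [v(x)] is again a quadratic
   [qform Pi_k (x - r_k) / 2 + c_k], which are the two recursions.

   For uniqueness, Gibbs' inequality is needed with a remainder
   [eps (p U - q_x U)^2 / 2] for each measurable [U].  An optimal policy then gives
   the same mass as [q_x] to each box with rational corners, for almost every [x]
   under the law of [x_k]; there are countably many boxes and Lebesgue measure is
   dominated by the law of [x_k].

   The measurability of [x |-> KL(pi_k(x) || rho_k)] is never established: the
   lower bounds on the cost replace it by the measurable minorant that Gibbs'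
   inequality provides, and on the optimal policy it is known explicitly. *)

(** * Gibbs' variational principle *)

Section integral.
Local Open Scope ereal_scope.
Context d (T : measurableType d) (R : realType).

(* [g] need not be measurable, its integral being a supremum over the simple
   functions below it. *)
Lemma nnle_integral (mu : {measure set T -> \bar R}) (f g : T -> \bar R) :
  (forall x, 0 <= f x) -> (forall x, f x <= g x) ->
  \int[mu]_x f x <= \int[mu]_x g x.
Proof.
move=> f0 fg.
have g0 x : 0 <= g x by exact: le_trans (f0 x) (fg x).
rewrite !ge0_integralTE//; apply: le_ereal_sup => _ [h hf <-]; exists h => //.
by move=> x; exact: le_trans (hf x) (fg x).
Qed.

(** Positive and negative parts are compared separately, so neither function has to be integrable:
    in [kl_div_ge_integrable] the right-hand side is a log-density whose integral may be
    infinite. *)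
Lemma ae_le_integral (mu : {measure set T -> \bar R}) (f g : T -> \bar R) :
  measurable_fun setT f -> measurable_fun setT g ->
  {ae mu, forall x, f x <= g x} ->
  \int[mu]_x f x <= \int[mu]_x g x.
Proof.
move=> mf mg fg; rewrite integralE [leRHS]integralE; apply: leeB.
  apply: ae_ge0_le_integral => //; try exact: measurable_funepos.
  by apply: filterS fg => x fg _; rewrite !funeposE le_max2.
apply: ae_ge0_le_integral => //; try exact: measurable_funeneg.
by apply: filterS fg => x fg _; rewrite !funenegE le_max2// leeN2.
Qed.

Lemma measurable_lne : measurable_fun setT (@lne R).
Proof.
rewrite (_ : @lne R = fun x => if x <= 0 then -oo else
    if x == +oo then +oo else (ln (fine x))%:E); last first.
  by apply/funext => -[r| |]//=; rewrite leNye.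
apply: measurable_fun_ifT => //; first exact: measurable_fun_lee.
apply: measurable_fun_ifT => //; first exact: measurable_fun_eqe.
apply/measurable_EFinP; apply: measurableT_comp; first exact: measurable_ln.
exact: fine_measurable.
Qed.

End integral.

Section gibbs.
Context d (T : measurableType d) (R : realType).
Implicit Types (p q rho : probability T R).

(** Replaces the derivative in [kl_div], extended-real and fixed only up to null sets, by a real
    density that is nonnegative everywhere. Its zero set has [p]-mass equal to an integral of 0, so
    under [p] the logarithm is almost everywhere that of a positive number. *)
Lemma kl_div_density p rho : p `<< rho ->
  exists f : T -> R, [/\ measurable_fun setT f, forall u, 0 <= f u,
    {ae p, forall u, 0 < f u},
    forall A (g : T -> \bar R), measurable A -> measurable_fun A g ->
      (forall u, 0 <= g u)%E ->
      (\int[p]_(u in A) g u = \int[rho]_(u in A) (g u * (f u)%:E))%E &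
    (kl_div p rho = \int[p]_u (ln (f u))%:E)%E].
Proof.
move=> prho.
pose F := Radon_Nikodym_SigmaFinite.f p rho.
have Ffin : forall u, F u \is a fin_num by exact: Radon_Nikodym_SigmaFinite.f_fin_num.
have F0 : forall u, (0 <= F u)%E by exact: Radon_Nikodym_SigmaFinite.f_ge0.
have mF : measurable_fun setT F.
  exact: measurable_int (Radon_Nikodym_SigmaFinite.f_integrable prho).
have fE u : (fine (F u))%:E = F u by rewrite fineK.
pose f u := fine (F u).
have mf : measurable_fun setT f.
  by apply: measurableT_comp => //; exact: fine_measurable.
have f0 u : 0 <= f u by rewrite /f fine_ge0.
have ch A (g : T -> \bar R) : measurable A -> measurable_fun A g ->
    (forall u, 0 <= g u)%E ->
    (\int[p]_(u in A) g u = \int[rho]_(u in A) (g u * (f u)%:E))%E.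
  move=> mA mg g0; rewrite -(Radon_Nikodym_SigmaFinite.change_of_variables prho)//.
  by apply: eq_integral => u _; rewrite /f fE.
have pf : {ae p, forall u, 0 < f u}.
  have mN : measurable (f @^-1` [set 0]).
    by rewrite -[X in measurable X]setTI; apply: mf.
  exists (f @^-1` [set 0]); split => //.
    transitivity (\int[p]_u (\1_(f @^-1` [set 0]) u)%:E)%E.
      by rewrite integral_indic// setIT.
    rewrite ch//; last by apply/measurable_EFinP; exact: measurable_indic.
    apply: integral0_eq => u _; rewrite indicE.
    by case: (boolP (u \in _)) => [|_]; rewrite ?mul0e// inE/= => ->; rewrite mule0.
  by move=> u /= /negP; rewrite -leNgt => fu; apply/eqP; rewrite eq_le fu f0.
exists f; split => //.
rewrite /kl_div asboolT//; apply: ae_eq_integral => //.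
- apply: measurableT_comp; first exact: measurable_lne.
  exact: measurable_int (Radon_Nikodym_integrable _).
- by apply/measurable_EFinP; apply: measurableT_comp => //; exact: measurable_ln.
have := ae_eq_Radon_Nikodym_SigmaFinite prho measurableT.
move=> /(null_dominates_ae_eq measurableT prho); apply: filterS2 pf => u fu.
move=> /(_ I) <- _.
by rewrite -[Radon_Nikodym_SigmaFinite.f _ _ _]/(F u) -fE lne_EFin.
Qed.

(** Uses [ln (1 + y) >= y - 2 y^2] for [y >= - 1 / 2], at [y = h] with weight [s] and at [y = - h]
    with weight [1 - s]. The right-hand side is then at least [2 h (s - t) - 2 h^2], which the
    chosen [h] maximises. *)
Lemma kl_bound_scalar (s t : R) : 0 <= s <= 1 -> 0 <= t <= 1 ->
  let h := (s - t) / 2 in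
  (s - t) ^+ 2 / 2 <=
    1 + ln (1 - h) + (ln (1 + h) - ln (1 - h)) * s - (1 - h + 2 * h * t).
Proof.
move=> /andP[s0 s1] /andP[t0 t1]; cbv zeta; set h := (s - t) / 2.
have lnge (y : R) : - 2^-1 <= y -> y - 2 * y ^+ 2 <= ln (1 + y).
  move=> y2; have y0 : 0 < 1 + y by lra.
  have : ln ((1 + y)^-1) <= (1 + y)^-1 - 1.
    have := @le_ln1Dx R ((1 + y)^-1 - 1).
    rewrite addrCA subrr addr0; apply.
    by rewrite ltrBDr addNr invr_gt0.
  rewrite lnV ?posrE// => le1.
  have : (1 + y)^-1 <= 1 - y + 2 * y ^+ 2.
    rewrite -div1r ler_pdivrMr//.
    have -> : (1 - y + 2 * y ^+ 2) * (1 + y) = 1 + y ^+ 2 * (1 + 2 * y) by ring.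
    by rewrite lerDl mulr_ge0 ?sqr_ge0//; lra.
  by move: le1; lra.
have h1 : - 2^-1 <= h by rewrite /h; lra.
have h2 : - 2^-1 <= - h by rewrite /h; lra.
have l1 := lnge _ h1; have l2 := lnge _ h2.
have sl1 : s * (h - 2 * h ^+ 2) <= s * ln (1 + h) by exact: ler_wpM2l.
have sl2 : (1 - s) * (- h - 2 * (- h) ^+ 2) <= (1 - s) * ln (1 - h).
  by apply: ler_wpM2l => //; lra.
have -> : (s - t) ^+ 2 / 2 = 2 * h * (s - t) - 2 * h ^+ 2 by rewrite /h; field.
by move: sl1 sl2; rewrite sqrrN; nra.
Qed.

(* Integrates [ln z <= z - 1] at [z = w e^psi / f], where [f] is the density of [p]
   and the weight [w] is [1 + h] on [U] and [1 - h] off [U]; with [w = 1] this is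
   the usual proof of Gibbs' inequality, and [h = (p U - q U) / 2] produces the
   remainder. *)
Lemma kl_div_ge_integrable p q rho (psi : T -> R) (U : set T) :
  measurable U -> p.-integrable setT (EFin \o psi) ->
  measurable_fun setT psi ->
  (forall V, measurable V -> q V = \int[rho]_(u in V) (expR (psi u))%:E)%E ->
  (\int[p]_u (psi u)%:E + ((fine (p U) - fine (q U)) ^+ 2 / 2)%:E
     <= kl_div p rho)%E.
Proof.
move=> mU ipsi mpsi qE.
have [prho|nprho] := pselect (p `<< rho); last first.
  by rewrite /kl_div asboolF// leey.
have [f [mf f0 pf ch ->]] := kl_div_density prho.
set s := fine (p U); set t := fine (q U).
have sE : p U = s%:E by rewrite /s fineK// fin_num_measure.
have tE : q U = t%:E by rewrite /t fineK// fin_num_measure.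
have s01 : 0 <= s <= 1 by rewrite -!lee_fin -sE measure_ge0 probability_le1.
have t01 : 0 <= t <= 1 by rewrite -!lee_fin -tE measure_ge0 probability_le1.
pose h := (s - t) / 2.
have h1 : 0 < 1 + h by move: s01 t01; rewrite /h => /andP[? ?] /andP[? ?]; lra.
have h2 : 0 < 1 - h by move: s01 t01; rewrite /h => /andP[? ?] /andP[? ?]; lra.
pose w u := 1 - h + 2 * h * \1_U u.
pose a := 1 + ln (1 - h); pose b := ln (1 + h) - ln (1 - h).
(* [1 + ln w] is affine in the indicator of [U], so its [p]-integral is [a + b s], as in
   [kl_bound_scalar]. *)
have wE u : [/\ 0 < w u & 1 + ln (w u) = a + b * \1_U u].
  rewrite /w /a /b indicE; case: (u \in U); rewrite ?(mulr1, mulr0, addr0)//.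
  have -> : 1 - h + 2 * h = 1 + h by ring.
  by split => //; ring.
(* Where [f u = 0], Rocq's [ln 0 = 0] gives a junk value of [z u], which [f]
   annihilates. *)
pose z u := w u * expR (psi u - ln (f u)).
have mi : measurable_fun setT (fun u => \1_U u : R) by exact: measurable_indic.
have mw : measurable_fun setT w by apply: measurable_funD => //; exact: measurable_funM.
have mlnf : measurable_fun setT (fun u => ln (f u)).
  by apply: measurableT_comp => //; exact: measurable_ln.
have mz : measurable_fun setT z.
  by apply: measurable_funM => //; apply: measurableT_comp => //; exact: measurable_funB.
have z0 u : 0 <= z u by rewrite mulr_ge0 ?expR_ge0// ltW// (wE u).1.
have ii (c : R) : p.-integrable setT (fun u => (c * \1_U u)%:E).
  apply: (@integrableZl _ _ _ p _ measurableT c (EFin \o \1_U)).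
  by apply: integrable_indic => //; exact: fin_num_measure.
(* [z f <= w e^psi], with equality where [f] is positive, and [e^psi] is the density of [q];
   integrating [w] against [q] gives the bound. *)
have zle : (\int[p]_u (z u)%:E <= (1 - h + 2 * h * t)%:E)%E.
  rewrite ch//; [|exact/measurable_EFinP].
  apply: (@le_trans _ _ (\int[rho]_u (w u * expR (psi u))%:E)%E).
    apply: nnle_integral => u; rewrite -EFinM lee_fin; first exact: mulr_ge0.
    rewrite /z; have [fu0|fu0] := eqVneq (f u) 0.
      by rewrite fu0 mulr0 mulr_ge0 ?expR_ge0// ltW// (wE u).1.
    rewrite expRB lnK ?posrE; last by rewrite lt0r fu0 f0.
    by rewrite -mulrA divfK.
  have ie : rho.-integrable setT (EFin \o (expR \o psi)).
    apply/integrableP; split; first by apply/measurable_EFinP; exact: measurableT_comp.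
    under eq_integral do rewrite gee0_abs ?lee_fin ?expR_ge0//.
    by rewrite /= -qE// probability_setT ltry.
  have -> : (fun u => (w u * expR (psi u))%:E) =
      (fun u => (1 - h)%:E * (expR (psi u))%:E +
                (2 * h)%:E * ((expR (psi u))%:E * (\1_U u)%:E))%E.
    by apply/funext => u; rewrite -!EFinM -EFinD /w; congr EFin; ring.
  have ieU : rho.-integrable setT (fun u => (expR (psi u))%:E * (\1_U u)%:E)%E.
    apply: le_integrable ie => //.
      by apply/measurable_EFinP; apply: measurable_funM => //; exact: measurableT_comp.
    move=> u _; rewrite /= lee_fin !normrM ler_piMr// indicE.
    by case: (_ \in _); rewrite ?normr1 ?normr0.
  rewrite integralD//; [|exact: integrableZl..].
  rewrite !integralZl//.
  rewrite [X in (_ + _ * X <= _)%E](_ : _ = q U); last first.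
    by rewrite qE// [RHS]integral_mkcond epatch_indic.
  rewrite -qE// probability_setT.
  by rewrite tE -!EFinM -EFinD mulr1.
have iz : p.-integrable setT (EFin \o z).
  apply/integrableP; split; first exact/measurable_EFinP.
  under eq_integral do rewrite gee0_abs ?lee_fin//.
  by rewrite (le_lt_trans zle) ?ltry.
have iab : p.-integrable setT (fun u => (a + b * \1_U u)%:E).
  rewrite -[X in p.-integrable _ X]/((EFin \o cst a) \+ (fun u => (b * \1_U u)%:E))%E.
  by apply: integrableD => //; exact: finite_measure_integrable_cst.
have ia : p.-integrable setT (fun u => (psi u + (a + b * \1_U u))%:E).
  rewrite -[X in p.-integrable _ X]/((EFin \o psi) \+ (fun u => (a + b * \1_U u)%:E))%E.
  exact: integrableD.
(* The intermediate integrand is [psi + 1 + ln w - z]. Its integral dominates the left-hand side by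
   [kl_bound_scalar]; it is below [ln f] almost everywhere, by [ln z <= z - 1] with
   [ln z = ln w + psi - ln f]. *)
apply: (@le_trans _ _ (\int[p]_u ((psi u + (a + b * \1_U u))%:E - (z u)%:E))%E).
  rewrite integralB//.
  under [X in (_ <= X - _)%E]eq_integral do rewrite EFinD.
  rewrite integralD// -[leRHS]addeA; apply: leeD2l.
  under [X in (_ <= X - _)%E]eq_integral do rewrite EFinD.
  rewrite integralD//; last by apply: finite_measure_integrable_cst.
  rewrite integral_cst// [X in (_ * X)%E]probability_setT mule1.
  under [X in (_ <= _ + X - _)%E]eq_integral do rewrite EFinM.
  rewrite integralZl//; last first.
    by apply: integrable_indic => //; exact: fin_num_measure.
  rewrite integral_indic// setIT [X in (_ * X)%E]sE -EFinM -EFinD.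
  apply: le_trans (leeB (lexx _) zle).
  by rewrite -EFinB lee_fin; exact: kl_bound_scalar.
apply: ae_le_integral.
- by apply: emeasurable_funB; apply/measurable_EFinP => //;
    do 2![apply: measurable_funD => //]; exact: measurable_funM.
- exact/measurable_EFinP.
apply: filterS pf => u fu; rewrite -EFinB lee_fin.
have [w0 <-] := wE u.
have zu : 0 < z u by rewrite /z mulr_gt0// expR_gt0.
have : ln (z u) <= z u - 1.
  have := @le_ln1Dx R (z u - 1).
  rewrite addrCA subrr addr0; apply.
  by rewrite ltrBDr addNr.
have -> : ln (z u) = ln (w u) + psi u - ln (f u).
  by rewrite /z lnM ?posrE ?expR_gt0// expRK addrA.
by lra.
Qed.

(** The previous inequality at [psi = 0], [q = rho] and [U] empty. *)
Lemma kl_div_ge0 p rho : (0 <= kl_div p rho)%E.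
Proof.
have i0 : p.-integrable setT (EFin \o (cst 0 : T -> R)).
  by apply: eq_integrable (integrable0 _ _) => //.
have qE V : measurable V ->
    (rho V = \int[rho]_(u in V) (expR ((cst 0 : T -> R) u))%:E)%E.
  by move=> mV; rewrite /= expR0 integral_cst// mul1e.
have := kl_div_ge_integrable measurable0 i0 (measurable_cst _) qE.
by rewrite !measure0/= subrr expr0n/= mul0r adde0 integral0.
Qed.

Section gibbs_state.
Variables (rho q : probability T R) (eps v : R) (c : T -> R).
Hypotheses (eps0 : 0 < eps) (c0 : forall u, 0 <= c u).
Hypotheses (mc : measurable_fun setT c).
Hypotheses (qE : forall V, measurable V ->
  (q V = \int[rho]_(u in V) (expR ((v - c u) / eps))%:E)%E).

Let mpsi : measurable_fun setT (fun u => (v - c u) / eps).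
Proof. by apply: measurable_funM => //; exact: measurable_funB. Qed.

Let integrable_psi p : (\int[p]_u (c u)%:E < +oo)%E ->
  p.-integrable setT (EFin \o (fun u => (v - c u) / eps)) /\
  (\int[p]_u ((v - c u) / eps)%:E = ((v - fine (\int[p]_u (c u)%:E)) / eps)%:E)%E.
Proof.
move=> coo.
have ic : p.-integrable setT (EFin \o c).
  apply/integrableP; split; first exact/measurable_EFinP.
  by under eq_integral do rewrite gee0_abs ?lee_fin//.
have iv : p.-integrable setT (EFin \o cst v) by exact: finite_measure_integrable_cst.
have ivc : p.-integrable setT (fun u => (v - c u)%:E).
  rewrite -[X in p.-integrable _ X]/((EFin \o cst v) \- (EFin \o c))%E.
  exact: integrableB.
split.
  rewrite (_ : _ \o _ = fun u => eps^-1%:E * (v - c u)%:E)%E; first exact: integrableZl.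
  by apply/funext => u; rewrite -EFinM mulrC.
under eq_integral do rewrite mulrC EFinM.
rewrite integralZl// mulrC EFinM; congr (_ * _)%E.
under eq_integral do rewrite EFinB.
rewrite integralB// integral_cst// [X in (_ * X)%E]probability_setT mule1 EFinB fineK//.
by rewrite ge0_fin_numE// integral_ge0// => u _; rewrite lee_fin.
Qed.

(** This is [kl_div_ge_integrable] at [psi = (v - c) / eps], multiplied by [eps]. If [c] has
    infinite mean then [psi] is not integrable, but the right-hand side is [+oo] since the
    divergence is nonnegative. *)
Lemma gibbs_le p U : measurable U ->
  ((v + eps * ((fine (p U) - fine (q U)) ^+ 2 / 2))%:E <=
    \int[p]_u (c u)%:E + eps%:E * kl_div p rho)%E.
Proof.
move=> mU.
have [coo|] := ltP (\int[p]_u (c u)%:E)%E +oo%E; last first.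
  rewrite leye_eq => /eqP ->; rewrite addye ?leey//.
  have KL0 : (0 <= eps%:E * kl_div p rho)%E.
    by apply: mule_ge0; [rewrite lee_fin ltW|exact: kl_div_ge0].
  by rewrite gt_eqF// (lt_le_trans _ KL0).
have [ipsi psiE] := integrable_psi coo.
have := kl_div_ge_integrable mU ipsi mpsi qE.
rewrite psiE -EFinD.
have -> : (\int[p]_u (c u)%:E = (fine (\int[p]_u (c u)%:E))%:E)%E.
  by rewrite fineK// ge0_fin_numE// integral_ge0// => u _; rewrite lee_fin.
set C := fine _; set D := _ ^+ 2 / 2 => le1.
have : (eps%:E * ((v - C) / eps + D)%:E <= eps%:E * kl_div p rho)%E.
  by rewrite lee_pmul2l// lte_fin.
move/(leeD2l C%:E); apply: le_trans.
rewrite -EFinM -EFinD lee_fin le_eqVlt; apply/orP; left; apply/eqP.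
by field; rewrite gt_eqF.
Qed.

Let qrho : q `<< rho.
Proof.
apply/null_content_dominatesP => A mA rA; rewrite qE//.
apply: null_set_integral => //.
by apply/measurable_EFinP; apply: measurable_funTS; exact: measurableT_comp.
Qed.

(** Both functions have integral [q A] over every measurable [A], and the exponential is integrable
    because [q] has mass 1. *)
Let density_q (f : T -> R) : measurable_fun setT f ->
  (forall A (g : T -> \bar R), measurable A -> measurable_fun A g ->
      (forall u, 0 <= g u)%E ->
    \int[q]_(u in A) g u = \int[rho]_(u in A) (g u * (f u)%:E))%E ->
  {ae rho, forall u, expR ((v - c u) / eps) = f u}.
Proof.
move=> mf ch.
have me : measurable_fun setT (EFin \o (fun u => expR ((v - c u) / eps))).
  by apply/measurable_EFinP; exact: measurableT_comp.
have : ae_eq rho setT (EFin \o (fun u => expR ((v - c u) / eps))) (EFin \o f).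
  apply: integral_ae_eq => //.
  - apply/integrableP; split => //.
    under eq_integral => u _ do rewrite [`|_|%E]gee0_abs ?lee_fin ?expR_ge0//.
    by rewrite -qE// probability_setT ltry.
  - exact/measurable_EFinP.
  - move=> A _ mA /=; rewrite -qE//.
    have := ch A (cst 1%E) mA (measurable_cst _) (fun=> lee01).
    rewrite integral_cst// mul1e => ->.
    by apply: eq_integral => u _; rewrite mul1e.
by apply: filterS => u /(_ I) [].
Qed.

(* The density of [q] tames [c], because [t e^{-t} <= 1] at [t = c / eps]. *)
Lemma gibbs_integral_lty : (\int[q]_u (c u)%:E < +oo)%E.
Proof.
have [f [mf f0 _ ch _]] := kl_div_density qrho.
rewrite ch//; last exact/measurable_EFinP.
apply: (@le_lt_trans _ _ (\int[rho]_u (cst (eps * expR (v / eps))%:E u))%E).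
  apply: ae_ge0_le_integral => //.
  - by move=> u _; rewrite -EFinM lee_fin mulr_ge0.
  - by apply/measurable_EFinP; exact: measurable_funM.
  - by move=> u _; rewrite lee_fin mulr_ge0 ?expR_ge0// ltW.
  apply: filterS (density_q mf ch) => u <- _; rewrite -EFinM lee_fin.
  rewrite mulrBl expRB mulrCA [leRHS]mulrC ler_pM2l ?expR_gt0//.
  rewrite ler_pdivrMr ?expR_gt0// mulrC -ler_pdivrMr//.
  by rewrite (le_trans _ (expR_ge1Dx _))// lerDr.
by rewrite integral_cst// [X in (_ * X)%E]probability_setT mule1 ltry.
Qed.

(** The log-density of [q] is [(v - c) / eps] almost everywhere, and its mean can be split because
    [c] has finite mean under [q]. *)
Lemma gibbs_eq : (\int[q]_u (c u)%:E + eps%:E * kl_div q rho = v%:E)%E.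
Proof.
have [ipsi psiE] := integrable_psi gibbs_integral_lty.
have -> : kl_div q rho = (((v - fine (\int[q]_u (c u)%:E)) / eps)%:E)%E.
  have [f [mf f0 _ ch ->]] := kl_div_density qrho.
  rewrite -psiE; apply: ae_eq_integral => //.
  - by apply/measurable_EFinP; apply: measurableT_comp => //; exact: measurable_ln.
  - exact/measurable_EFinP.
  apply: (null_dominates_ae_eq measurableT qrho).
  by apply: filterS (density_q mf ch) => u <- _; rewrite expRK.
have -> : (\int[q]_u (c u)%:E = (fine (\int[q]_u (c u)%:E))%:E)%E.
  by rewrite fineK// ge0_fin_numE// ?gibbs_integral_lty// integral_ge0// => u _; rewrite lee_fin.
by rewrite -EFinM -EFinD; congr EFin; field; rewrite gt_eqF.
Qed.

(** By [gibbs_eq], [v] is a sum of nonnegative terms. This will give the sign of the additive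
    constants in the value functions without evaluating them. *)
Lemma gibbs_ge0 : 0 <= v.
Proof.
rewrite -lee_fin -gibbs_eq; apply: adde_ge0.
  by apply: integral_ge0 => u _; rewrite lee_fin.
by apply: mule_ge0; [rewrite lee_fin ltW|exact: kl_div_ge0].
Qed.

End gibbs_state.
End gibbs.

(** * Integration with respect to semidirect products, densities and Gaussians *)

(* [semidirect P K] is a composition of kernels, through the kernel that sends [x]
   to the law of [(x, y)] when [y] has law [K x]; this gives access to
   [integral_kcomp]. *)
Section semidirect_integral.
Context d1 d2 (X : measurableType d1) (Y : measurableType d2) (R : realType).

Section cst_kernel.
Variable P : probability X R.

Definition cst_kernel (_ : unit) : {measure set X -> \bar R} := P.

Let measurable_cst_kernel U : measurable U ->
  measurable_fun [set: unit] (cst_kernel ^~ U).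
Proof. by move=> _; exact: measurable_cst. Qed.

HB.instance Definition _ := isKernel.Build _ _ _ _ _ cst_kernel measurable_cst_kernel.

Let cst_kernel_prob x : cst_kernel x setT = 1%E.
Proof. exact: probability_setT. Qed.

HB.instance Definition _ := Kernel_isProbability.Build _ _ _ _ _ cst_kernel cst_kernel_prob.

End cst_kernel.

Section graph_kernel.
Variable K : R.-pker X ~> Y.

Definition pair_mfun (x : X) : {mfun Y >-> (X * Y)%type} :=
  mfun_Sub (mem_set (measurable_pair1 x)).

Section graph_measure.
Variable x : X.

Definition graph_measure : set (X * Y) -> \bar R := pushforward (K x) (pair_mfun x).

Let graph_measure0 : graph_measure set0 = 0%E.
Proof. by rewrite /graph_measure /pushforward preimage_set0 measure0. Qed.

Let graph_measure_ge0 A : (0 <= graph_measure A)%E.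
Proof. exact: measure_ge0. Qed.

Let graph_measure_sigma_additive : semi_sigma_additive graph_measure.
Proof. exact: measure_semi_sigma_additive. Qed.

HB.instance Definition _ := isMeasure.Build _ _ _ graph_measure
  graph_measure0 graph_measure_ge0 graph_measure_sigma_additive.

End graph_measure.

Definition graph_kernel (p : unit * X) : {measure set (X * Y) -> \bar R} :=
  graph_measure p.2.

Let measurable_graph_kernel U : measurable U ->
  measurable_fun [set: unit * X] (graph_kernel ^~ U).
Proof.
move=> mU; have mK : measurable_fun setT (fun x => K x (xsection U x)).
  by apply: measurable_fun_xsection_finite_kernel; rewrite inE.
rewrite (_ : graph_kernel ^~ U = (fun x => K x (xsection U x)) \o snd).
  exact: measurableT_comp.
by apply/funext => p /=; rewrite /graph_kernel /= /graph_measure /pushforward/= xsectionE.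
Qed.

HB.instance Definition _ := isKernel.Build _ _ _ _ _ graph_kernel measurable_graph_kernel.

Let graph_kernel_prob p : graph_kernel p setT = 1%E.
Proof. by rewrite /graph_kernel /= /graph_measure /pushforward/= preimage_setT prob_kernel. Qed.

HB.instance Definition _ := Kernel_isProbability.Build _ _ _ _ _ graph_kernel graph_kernel_prob.

End graph_kernel.

Lemma integral_semidirect (P : probability X R) (K : R.-pker X ~> Y)
    (f : X * Y -> \bar R) :
  measurable_fun setT f -> (forall z, 0 <= f z)%E ->
  (\int[semidirect P K]_z f z = \int[P]_x \int[K x]_y f (x, y))%E.
Proof.
move=> mf f0.
transitivity (\int[kcomp (cst_kernel P) (graph_kernel K) tt]_z f z)%E.
  apply: eq_measure_integral => A mA _.
  rewrite /semidirect /kcomp; apply: eq_integral => x _.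
  by rewrite /graph_kernel /= /graph_measure /pushforward/= xsectionE.
rewrite integral_kcomp//; apply: eq_integral => x _.
by rewrite /graph_kernel ge0_integral_pushforward.
Qed.

End semidirect_integral.

Section density.
Context d (T : measurableType d) (R : realType).

(** The change of variables holds for the Radon-Nikodym derivative, and [g] agrees with it
    [mu]-almost everywhere. *)
Lemma integral_density (mu : {sigma_finite_measure set T -> \bar R})
    (nu : {finite_measure set T -> \bar R}) (g : T -> R) (f : T -> \bar R) :
  measurable_fun setT g -> (forall u, 0 <= g u) ->
  (forall A, measurable A -> nu A = \int[mu]_(u in A) (g u)%:E)%E ->
  measurable_fun setT f -> (forall u, 0 <= f u)%E ->
  (\int[nu]_u f u = \int[mu]_u (f u * (g u)%:E))%E.
Proof.
move=> mg g0 nuE mf f0.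
have numu : nu `<< mu.
  apply/null_content_dominatesP => A mA muA; rewrite nuE// null_set_integral//.
  by apply/measurable_EFinP; exact: measurable_funTS.
rewrite -(Radon_Nikodym_SigmaFinite.change_of_variables numu)//.
have iF := Radon_Nikodym_SigmaFinite.f_integrable numu.
have mF := measurable_int _ iF.
apply: ge0_ae_eq_integral => //.
- exact: emeasurable_funM.
- by apply: emeasurable_funM => //; exact/measurable_EFinP.
- by move=> u _; apply: mule_ge0 => //; apply: Radon_Nikodym_SigmaFinite.f_ge0.
- by move=> u _; rewrite mule_ge0 ?lee_fin.
have : ae_eq mu setT (Radon_Nikodym_SigmaFinite.f nu mu) (EFin \o g).
  apply: integral_ae_eq => //; first exact/measurable_EFinP.
  by move=> A _ mA; rewrite -nuE// -(Radon_Nikodym_SigmaFinite.f_integral numu).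
by apply: filterS => u /(_ I) /= ->.
Qed.

End density.

(** * Invariance of Lebesgue measure under translations and reflections *)

Section lebesgue_affine.
Context (R : realType).

(** The sign [s] treats translations and reflections together. The pushforward agrees with Lebesgue
    measure on half-open intervals, which determine it. *)
Lemma integral_lebesgue_affine (s : bool) (b : R) (f : R -> \bar R) :
  measurable_fun [set: measurableTypeR R] f -> (forall x, 0 <= f x)%E ->
  (\int[lebesgue_measure]_x f ((-1) ^+ s * x + b)%R = \int[lebesgue_measure]_x f x)%E.
Proof.
move=> mf f0.
pose phi (x : measurableTypeR R) : measurableTypeR R := (-1) ^+ s * x + b.
have mphi : measurable_fun setT phi.
  by apply: measurable_funD => //; exact: measurable_funM.
pose Phi := mfun_Sub (mem_set mphi).
transitivity (\int[pushforward lebesgue_measure Phi]_x f x)%E.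
  by rewrite ge0_integral_pushforward.
apply: eq_measure_integral => A mA _; apply/esym/lebesgue_measure_unique => //.
move=> _ [[x y]] _ <-.
(* This is the preimage of []x, y]]; a reflection exchanges the open and the closed end. *)
transitivity (lebesgue_measure
    (if s then `[b - y, b - x[%classic else `]x - b, y - b]%classic)); last first.
  congr lebesgue_measure; apply/seteqP; split => u /=;
    rewrite /phi !in_itv/=; case: (s) => /=;
    rewrite ?expr1 ?expr0 ?in_itv/= => /andP[? ?]; apply/andP; split; lra.
case: (s); rewrite !lebesgue_measure_itv/= !lte_fin -!EFinB.
  by rewrite ltrD2l ltrN2; case: ifP => // _; congr EFin; ring.
by rewrite ltrD2r; case: ifP => // _; congr EFin; ring.
Qed.

Lemma integral_lebesgue_cV_affine n (s : bool) (b : 'cV[R]_n) (f : 'cV[R]_n -> \bar R) :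
  measurable_fun setT f -> (forall x, 0 <= f x)%E ->
  (\int[lebesgue_cV n]_x f ((-1) ^+ s *: x + b)%R = \int[lebesgue_cV n]_x f x)%E.
Proof.
elim: n => [|n ih] in b f *; move=> mf f0.
  by apply: eq_integral => x _; rewrite [X in f X]flatmx0 [X in _ = f X]flatmx0.
have maff : measurable_fun setT (fun x : 'cV[R]_n.+1 => (-1) ^+ s *: x + b).
  apply: measurable_fun_mxP => i j; under eq_fun do rewrite !mxE.
  by apply: measurable_funD => //; apply: measurable_funM => //; exact: measurable_coord.
have mfaff : measurable_fun setT (fun x : 'cV[R]_n.+1 => f ((-1) ^+ s *: x + b)).
  exact: measurableT_comp.
rewrite /= /lebesgue_cons !ge0_integral_pushforward// preimage_setT.
rewrite !fubini_tonelli2//=; try by apply: measurableT_comp => //; exact: measurable_vcons.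
pose b' := vuncons b.
have E x y : (-1) ^+ s *: vcons (x, y) + b =
    vcons ((-1) ^+ s * x + b'.1, (-1) ^+ s *: y + b'.2).
  apply/colP => i; rewrite 2!mxE.
  by have [k ->|->] := unliftP ord0 i; rewrite ?vconsS ?vcons0//= !mxE.
pose G y := (\int[lebesgue_measure]_x f (vcons (x, y)))%E.
(* The inner integral absorbs the map on the first coordinate, and the induction hypothesis absorbs
   it on the others. *)
transitivity (\int[lebesgue_cV n]_y G ((-1) ^+ s *: y + b'.2)%R)%E.
  apply: eq_integral => y _; rewrite /fubini_G/=.
  under eq_integral do rewrite E.
  apply: (integral_lebesgue_affine s b'.1 (f := fun x => f (vcons (x, _)))) => //.
  apply: (measurableT_comp mf); apply: (measurableT_comp (@measurable_vcons _ _)).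
  by [exact: measurable_pair2 | exact: measurable_pair1].
rewrite ih//; last by move=> y; apply: integral_ge0.
apply: (measurable_fun_fubini_tonelli_G (f \o @vcons R n)) => //.
exact: (measurableT_comp mf (@measurable_vcons _ _)).
by move=> p; exact: f0.
Qed.

End lebesgue_affine.

(** * Algebra and comparison of quadratic forms *)

Section qform.
Context (R : realType).

Lemma qformE n (S : 'M[R]_n) v : qform S v = \sum_j \sum_i v i 0 * S i j * v j 0.
Proof.
rewrite /qform mxE; apply: eq_bigr => j _; rewrite mxE mulr_suml.
by apply: eq_bigr => i _; rewrite mxE.
Qed.

Lemma qform0 n (S : 'M[R]_n) : qform S 0 = 0.
Proof. by rewrite /qform mulmx0 mxE. Qed.

Lemma qformZ n (S : 'M[R]_n) (t : R) v : qform S (t *: v) = t ^+ 2 * qform S v.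
Proof. by rewrite /qform [_^T]linearZ/= -scalemxAr -!scalemxAl scalerA mxE expr2. Qed.

Lemma qformN n (S : 'M[R]_n) v : qform S (- v) = qform S v.
Proof. by rewrite -scaleN1r qformZ sqrrN expr1n mul1r. Qed.

Lemma qformZmx n (S : 'M[R]_n) (t : R) v : qform (t *: S) v = t * qform S v.
Proof. by rewrite /qform -scalemxAr -scalemxAl mxE. Qed.

Lemma qformDmx n (S S' : 'M[R]_n) v : qform (S + S') v = qform S v + qform S' v.
Proof. by rewrite /qform mulmxDr mulmxDl mxE. Qed.

Lemma qformD n (S : 'M[R]_n) u v : S^T = S ->
  qform S (u + v) = qform S u + 2 * (u^T *m S *m v) 0 0 + qform S v.
Proof.
move=> tS; rewrite /qform [(u + v)^T]linearD/= mulmxDl mulmxDr !mulmxDl.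
have addE (M N : 'M[R]_1) : (M + N) 0 0 = M 0 0 + N 0 0 by rewrite mxE.
rewrite !addE.
have -> : (v^T *m S *m u) 0 0 = (u^T *m S *m v) 0 0.
  transitivity ((v^T *m S *m u)^T 0 0); first by rewrite [RHS]mxE.
  by rewrite !trmx_mul tS trmxK mulmxA.
by ring.
Qed.

Lemma posdefmxZ n (S : 'M[R]_n) (t : R) : 0 < t -> posdefmx S -> posdefmx (t *: S).
Proof.
move=> t0 [tS S0]; split; first by rewrite linearZ/= tS.
by move=> v v0; rewrite qformZmx mulr_gt0// S0.
Qed.

Lemma posdefmxD n (S S' : 'M[R]_n) : posdefmx S -> posdefmx S' -> posdefmx (S + S').
Proof.
move=> [tS S0] [tS' S'0]; split; first by rewrite linearD/= tS tS'.
by move=> v v0; rewrite qformDmx addr_gt0 ?S0 ?S'0.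
Qed.

Lemma qform_parallelogram n (S : 'M[R]_n) u v :
  qform S (u + v) + qform S (u - v) = 2 * qform S u + 2 * qform S v.
Proof.
rewrite /qform [(u + v)^T]linearD [(u - v)^T]linearB/=.
rewrite !(mulmxDl, mulmxDr, mulNmx, mulmxN).
have addE (M N : 'M[R]_1) : (M + N) 0 0 = M 0 0 + N 0 0 by rewrite mxE.
have oppE (M : 'M[R]_1) : (- M) 0 0 = - M 0 0 by rewrite mxE.
rewrite !(addE, oppE).
by ring.
Qed.

(* Cauchy-Schwarz for the inner product given by [S], applied to [v] and to
   [S^-1 e_i]. *)
Lemma sqr_coord_le_qform n (S : 'M[R]_n) i : posdefmx S ->
  exists2 a : R, 0 < a & forall v : 'cV[R]_n, (v i 0) ^+ 2 <= a * qform S v.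
Proof.
move=> pS; pose e : 'cV[R]_n := delta_mx i 0.
pose w := invmx S *m e.
have uS := posdefmx_unit pS.
have Sw : S *m w = e by rewrite /w mulKVmx.
have w0 : w != 0.
  apply/eqP => w0; have := Sw; rewrite w0 mulmx0 => /colP /(_ i) /eqP.
  by rewrite !mxE !eqxx eq_sym oner_eq0.
have a0 : 0 < qform S w by exact: (proj2 pS).
exists (qform S w) => // v.
pose t := - v i 0 / qform S w.
have := posdefmx_qform_ge0 (v + t *: w) pS.
rewrite qformD ?(proj1 pS)// qformZ.
have -> : (v^T *m S *m (t *: w)) 0 0 = t * v i 0.
  rewrite -scalemxAr -mulmxA Sw mxE; congr (_ * _).
  rewrite mxE (bigD1 i)//= !mxE !eqxx mulr1 big1 ?addr0// => j ji.
  by rewrite !mxE (negPf ji) mulr0.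
rewrite /t; set a := qform S w; set x := v i 0; set y := qform S v.
have a0' : a != 0 by rewrite gt_eqF.
have -> : y + 2 * (- x / a * x) + (- x / a) ^+ 2 * a = (a * y - x ^+ 2) / a.
  by field.
by rewrite pmulr_lge0 ?invr_gt0// subr_ge0.
Qed.

(** Each product [v_i v_j] is at most [v_i^2 + v_j^2] in absolute value, and [S] controls the
    squared coordinates. This compares an arbitrary form with the exponent of a Gaussian. *)
Lemma qform_le_posdef n (S P : 'M[R]_n) : posdefmx S ->
  exists2 C : R, 0 <= C & forall v, qform P v <= C * qform S v.
Proof.
move=> pS.
have /choice[a aE] : forall i : 'I_n, exists a : R,
    0 < a /\ forall v : 'cV[R]_n, (v i 0) ^+ 2 <= a * qform S v.
  by move=> i; have [a a0 aE] := sqr_coord_le_qform i pS; exists a.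
exists (\sum_j \sum_i `|P i j| * (a i + a j)).
  apply: sumr_ge0 => j _; apply: sumr_ge0 => i _.
  by rewrite mulr_ge0// addr_ge0// ltW// (aE _).1.
move=> v; rewrite qformE mulr_suml; apply: ler_sum => j _.
rewrite mulr_suml; apply: ler_sum => i _.
have ai := (aE i).2 v; have aj := (aE j).2 v.
set x := v i 0 in ai *; set y := v j 0 in aj *; set p := P i j; set q := qform S v in ai aj *.
rewrite -[leRHS]mulrA; apply: (@le_trans _ _ (`|p| * `|x * y|)).
  by rewrite -normrM (mulrC x) -mulrA ler_norm.
apply: ler_wpM2l => //; apply: (@le_trans _ _ (x ^+ 2 + y ^+ 2)); last by rewrite mulrDl lerD.
by rewrite ler_norml; apply/andP; split; nra.
Qed.

End qform.

(** * Gaussian integrals of quadratic forms *)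

Section gaussian_moments.
Context (R : realType) (n : nat).
Implicit Types (mu : 'cV[R]_n) (Sigma P : 'M[R]_n).

Lemma gaussian_pdf_gt0 mu Sigma u : 0 < gaussian_pdf mu Sigma u.
Proof.
rewrite /gaussian_pdf; set S := if _ then _ else _.
have pS : posdefmx S by rewrite /S; case: asboolP => // _; exact: posdefmx1.
have [dS _] := integral_expR_qform mu pS.
by rewrite divr_gt0 ?expR_gt0// sqrtr_gt0 mulr_gt0// exprn_gt0// mulr_gt0// pi_gt0.
Qed.

Lemma integral_gaussian mu Sigma (f : 'cV[R]_n -> \bar R) :
  measurable_fun setT f -> (forall u, 0 <= f u)%E ->
  (\int[gaussian mu Sigma]_u f u =
   \int[lebesgue_cV n]_u (f u * (gaussian_pdf mu Sigma u)%:E))%E.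
Proof.
by move=> mf f0; apply: integral_density => //;
  [exact: measurable_gaussian_pdf|exact: gaussian_pdf_ge0].
Qed.

(** The Gaussian density vanishes nowhere. *)
Lemma gaussian_null mu Sigma N : measurable N ->
  gaussian mu Sigma N = 0%E -> lebesgue_cV n N = 0%E.
Proof.
move=> mN; rewrite /gaussian => N0.
have mp : measurable_fun N (EFin \o gaussian_pdf mu Sigma).
  by apply/measurable_EFinP; apply: measurable_funTS; exact: measurable_gaussian_pdf.
have : (\int[lebesgue_cV n]_(u in N) `|(EFin \o gaussian_pdf mu Sigma) u| = 0)%E.
  rewrite -[RHS]N0; apply: eq_integral => u _.
  by rewrite gee0_abs// lee_fin gaussian_pdf_ge0.
move/(ae_eq_integral_abs _ mN mp) => [M [mM M0 NM]].
apply/eqP; rewrite eq_le measure_ge0 andbT -M0 le_measure ?inE// => u Nu.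
apply: NM => /= /(_ Nu) [] /eqP.
by rewrite gt_eqF// gaussian_pdf_gt0.
Qed.

(* With [q] the exponent's quadratic form, [q e^{-q/2} <= 4 e^{-q/4}], and the
   right-hand side is again a Gaussian density up to a factor. *)
Lemma gaussian_moment mu Sigma P : posdefmx P ->
  (\int[gaussian mu Sigma]_u (qform P (u - mu))%:E < +oo)%E.
Proof.
move=> pP; rewrite integral_gaussian; last 2 first.
- by apply/measurable_EFinP; exact: measurable_qform_sub.
- by move=> u; rewrite lee_fin posdefmx_qform_ge0.
rewrite /gaussian_pdf; set S0 := if _ then _ else _.
have pS0 : posdefmx S0 by rewrite /S0; case: asboolP => // _; exact: posdefmx1.
have pS := posdefmx_inv pS0; set S := invmx S0 in pS *.
set N := Num.sqrt _.
have N0 : 0 <= N by exact: sqrtr_ge0.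
have [C C0 PC] := qform_le_posdef P pS.
have pS2 : posdefmx (2^-1 *: S) by exact: posdefmxZ.
apply: (@le_lt_trans _ _ (\int[lebesgue_cV n]_u
    ((C * 4 / N)%:E * (expR (- qform (2^-1 *: S) (u - mu) / 2))%:E))%E).
  apply: nnle_integral => u; rewrite -EFinM lee_fin.
    by rewrite mulr_ge0 ?posdefmx_qform_ge0// divr_ge0 ?expR_ge0.
  rewrite qformZmx; set q := qform S _.
  have q0 : 0 <= q by exact: posdefmx_qform_ge0.
  rewrite mulrA [leRHS]mulrAC ler_wpM2r ?invr_ge0//.
  apply: (@le_trans _ _ (C * q * expR (- q / 2))).
    by rewrite ler_wpM2r ?expR_ge0//; exact: PC.
  rewrite -!mulrA; apply: ler_wpM2l => //.
  have -> : - q / 2 = - (2^-1 * q) / 2 - q / 4 by field.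
  rewrite expRD mulrA [q * _]mulrC -mulrA [leRHS]mulrC.
  apply: ler_wpM2l; first exact: expR_ge0.
  rewrite expRN ler_pdivrMr ?expR_gt0// -ler_pdivrMl// mulrC.
  by rewrite (le_trans _ (expR_ge1Dx _))// lerDr.
rewrite ge0_integralZl//; last 2 first.
- by apply/measurable_EFinP; exact: measurable_expR_qform.
- by rewrite lee_fin divr_ge0// mulr_ge0.
by rewrite (integral_expR_qform mu pS2).2 -EFinM ltry.
Qed.

Lemma gaussian0_sym Sigma (f : 'cV[R]_n -> \bar R) :
  measurable_fun setT f -> (forall u, 0 <= f u)%E ->
  (\int[gaussian 0 Sigma]_u f (- u)%R = \int[gaussian 0 Sigma]_u f u)%E.
Proof.
move=> mf f0.
have mN : measurable_fun setT (fun u : 'cV[R]_n => - u).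
  apply: measurable_fun_mxP => i j; under eq_fun do rewrite !mxE.
  by apply: measurableT_comp => //; exact: measurable_coord.
rewrite !integral_gaussian//; last exact: measurableT_comp.
rewrite -[RHS](integral_lebesgue_cV_affine true 0); last 2 first.
- apply: emeasurable_funM => //.
  by apply/measurable_EFinP; exact: measurable_gaussian_pdf.
- by move=> u; rewrite mule_ge0// lee_fin gaussian_pdf_ge0.
apply: eq_integral => u _; rewrite expr1 scaleN1r addr0.
by rewrite /gaussian_pdf !subr0 qformN.
Qed.

Lemma measurable_qform_add P (z : 'cV[R]_n) :
  measurable_fun setT (fun w : 'cV[R]_n => qform P (z + w)).
Proof.
apply: measurableT_comp; first exact: measurable_qform.
by apply: measurable_addmx; [exact: measurable_cst|exact: measurable_id].
Qed.

(* Averaging over [w] and [- w] turns the integrand into the parallelogram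
   identity, so that the mean of the Gaussian need not be computed. *)
Lemma gaussian0_qform_shift Sigma P : posdefmx P ->
  exists2 M : R, 0 <= M & forall z : 'cV[R]_n,
    (\int[gaussian 0 Sigma]_w (qform P (z + w))%:E = (qform P z + M)%:E)%E.
Proof.
move=> pP; have := gaussian_moment 0 Sigma pP.
under eq_integral do rewrite subr0.
move=> Moo.
have M0 : (0 <= \int[gaussian 0 Sigma]_w (qform P w)%:E)%E.
  by apply: integral_ge0 => u _; rewrite lee_fin posdefmx_qform_ge0.
exists (fine (\int[gaussian 0 Sigma]_w (qform P w)%:E)); first exact: fine_ge0.
move=> z.
have q0 (a : 'cV[R]_n) : (0 <= (qform P a)%:E)%E.
  by rewrite lee_fin posdefmx_qform_ge0.
have mq y : measurable_fun setT (fun w : 'cV[R]_n => (qform P (y + w))%:E).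
  by apply/measurable_EFinP; exact: measurable_qform_add.
have mq' : measurable_fun setT (fun w : 'cV[R]_n => (qform P w)%:E).
  by apply/measurable_EFinP; exact: measurable_qform.
set I := (\int[_]_w _)%E.
have I2 : (I + I = (2 * qform P z)%:E + 2%:E * \int[gaussian 0 Sigma]_w (qform P w)%:E)%E.
  rewrite {2}/I -(gaussian0_sym Sigma (mq z))// /I -ge0_integralD//; last first.
    apply/measurable_EFinP; under eq_fun do rewrite -opprB qformN.
    exact: measurable_qform_sub.
  under eq_integral do rewrite -EFinD qform_parallelogram EFinD.
  rewrite ge0_integralD//; last 3 first.
  - by move=> w _; rewrite lee_fin mulr_ge0// posdefmx_qform_ge0.
  - by move=> w _; rewrite lee_fin mulr_ge0// posdefmx_qform_ge0.
  - by apply/measurable_EFinP; apply: measurable_funM => //; exact: measurable_qform.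
  rewrite integral_cst// [X in (_ * X)%E]probability_setT mule1; congr (_ + _)%E.
  by under eq_integral do rewrite EFinM; rewrite ge0_integralZl// lee_fin.
have I0 : (0 <= I)%E by exact: integral_ge0.
(* Finiteness allows the identity for [I + I] to be halved among real numbers. *)
have Ifin : I \is a fin_num.
  rewrite ge0_fin_numE// (@le_lt_trans _ _ (I + I)%E)// ?leeDl// I2.
  by rewrite lte_add_pinfty ?ltry// lte_mul_pinfty ?lee_fin.
move: I2; rewrite -(fineK Ifin) -[X in (_ + _ * X)%E]fineK ?ge0_fin_numE//.
rewrite -EFinM -!EFinD => -[I2]; congr EFin; lra.
Qed.

(** The parallelogram identity bounds the form at [u - z] by twice its values at [mu - z] and
    [u - mu]. *)
Lemma gaussian_qform_lty mu Sigma P (z : 'cV[R]_n) : posdefmx P ->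
  (\int[gaussian mu Sigma]_u (qform P (u - z))%:E < +oo)%E.
Proof.
move=> pP; have moo := gaussian_moment mu Sigma pP.
apply: (@le_lt_trans _ _ (\int[gaussian mu Sigma]_u
    ((2 * qform P (mu - z))%:E + 2%:E * (qform P (u - mu))%:E))%E).
  apply: nnle_integral => u; first by rewrite lee_fin posdefmx_qform_ge0.
  rewrite -EFinM -EFinD lee_fin -qform_parallelogram.
  rewrite (_ : mu - z + (u - mu) = u - z) ?lerDl ?posdefmx_qform_ge0//.
  by rewrite addrC addrA subrK.
rewrite ge0_integralD//; last 3 first.
- by move=> w _; rewrite lee_fin mulr_ge0// posdefmx_qform_ge0.
- by move=> w _; rewrite -EFinM lee_fin mulr_ge0// posdefmx_qform_ge0.
- by apply: measurable_funeM; apply/measurable_EFinP; exact: measurable_qform_sub.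
rewrite integral_cst// [X in (_ * X + _)%E]probability_setT mule1 ge0_integralZl//; last 2 first.
- by apply/measurable_EFinP; exact: measurable_qform_sub.
- by move=> w _; rewrite lee_fin posdefmx_qform_ge0.
by rewrite lte_add_pinfty ?ltry// lte_mul_pinfty ?lee_fin.
Qed.

End gaussian_moments.

Section gaussian_kernel.
Context d (X : measurableType d) (R : realType) (n : nat).
Variables (f : {mfun X >-> 'cV[R]_n}) (Sigma : 'M[R]_n).

Definition gaussian_kernel (x : X) : {measure set 'cV[R]_n -> \bar R} :=
  gaussian (f x) Sigma.

Let measurable_gaussian_kernel U : measurable U ->
  measurable_fun [set: X] (gaussian_kernel ^~ U).
Proof.
(* The mass of [U] is a partial integral of the jointly measurable function [g], so Tonelli gives
   its measurability in [x]. *)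
move=> mU; pose g (p : X * 'cV[R]_n) : \bar R :=
  ((\1_U p.2)%:E * (gaussian_pdf (f p.1) Sigma p.2)%:E)%E.
rewrite [X in measurable_fun _ X](_ : _ = fubini_F (lebesgue_cV n) g); last first.
  apply/funext => x; rewrite /gaussian_kernel /= /gaussian /fubini_F.
  rewrite [LHS]integral_mkcond epatch_indic.
  by apply: eq_integral => u _; rewrite /g/= muleC.
apply: measurable_fun_fubini_tonelli_F; last first.
  by move=> p; rewrite mule_ge0 ?lee_fin ?gaussian_pdf_ge0.
apply: emeasurable_funM.
  apply/measurable_EFinP; apply: (measurableT_comp (measurable_indic _)) => //.
apply/measurable_EFinP; apply: measurable_funM => //.
apply: measurableT_comp => //; apply: measurable_funM => //.
apply: measurableT_comp => //; apply: measurableT_comp; first exact: measurable_qform.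
apply: measurable_addmx => //.
apply: measurable_fun_mxP => i j; under eq_fun do rewrite mxE.
apply: measurableT_comp => //; apply: (measurableT_comp (measurable_coord i j)).
exact: measurableT_comp.
Qed.

HB.instance Definition _ := isKernel.Build _ _ _ _ _ gaussian_kernel
  measurable_gaussian_kernel.

Let gaussian_kernel_prob x : gaussian_kernel x setT = 1%E.
Proof. exact: probability_setT. Qed.

HB.instance Definition _ := Kernel_isProbability.Build _ _ _ _ _ gaussian_kernel
  gaussian_kernel_prob.

End gaussian_kernel.

Section translation.
Context (R : realType) (n : nat).

Lemma lebesgue_cV_translate (z : 'cV[R]_n) N : measurable N ->
  lebesgue_cV n [set w | N (z + w)] = lebesgue_cV n N.
Proof.
move=> mN.
have mz : measurable [set w | N (z + w)].
  rewrite -[X in measurable X]setTI.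
  have : measurable_fun setT (fun w : 'cV[R]_n => z + w).
    by apply: measurable_addmx; [exact: measurable_cst|exact: measurable_id].
  exact.
have := integral_lebesgue_cV_affine false z (f := fun x => (\1_N x)%:E).
rewrite [X in _ -> _ -> _ = X]integral_indic// setIT => <-; last 2 first.
- by apply/measurable_EFinP; exact: measurable_indic.
- by move=> x; rewrite lee_fin.
transitivity (\int[lebesgue_cV n]_w (\1_[set w | N (z + w)] w)%:E)%E.
  by rewrite integral_indic// setIT.
apply: eq_integral => u _; rewrite expr0 scale1r addrC.
by congr EFin; rewrite !indicE; congr (_ : bool)%:R; apply/idP/idP; rewrite !inE.
Qed.

End translation.

(** * A countable family of sets that determines a probability *)

Section rational_boxes.
Context (R : realType) (n : nat).

(** Lower orthants instead of bounded boxes: they are closed under intersection, by taking minima of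
    corners, and their index type is countable. *)
Definition ratbox (q : {ffun 'I_n -> rat}) : set 'cV[R]_n :=
  [set u | forall i, u i 0 <= ratr (q i)].

Lemma measurable_ratbox q : measurable (ratbox q).
Proof.
rewrite (_ : ratbox q = \bigcap_(i in [set: 'I_n]) [set u | u i 0 <= ratr (q i)]).
  apply: fin_bigcap_measurable => [|i _]; first exact: finite_finset.
  rewrite -[X in measurable X]setTI; apply: measurable_fun_le => //.
  exact: measurable_coord.
by apply/seteqP; split => u /= h i; [move=> _; exact: h|exact: h].
Qed.

Lemma ratbox_cover : \bigcup_k ratbox [ffun=> k%:R] = setT.
Proof.
rewrite -subTset => u _.
exists (\max_i (Num.truncn `|u i 0%R|%R).+1)%N => //= i; rewrite ffunE ratr_nat.
apply: le_trans (ler_norm _) _; apply: le_trans (ltW (truncnS_gt _)) _.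
by rewrite ler_nat; exact: leq_bigmax.
Qed.

Lemma setI_closed_ratbox : setI_closed (range ratbox).
Proof.
move=> _ _ [a _ <-] [b _ <-]; exists [ffun i => Num.min (a i) (b i)] => //.
apply/seteqP; split => [u h|u [ha hb] i].
  by split=> i; have := h i; rewrite ffunE => /le_trans; apply;
    rewrite ler_rat ge_min lexx ?orbT.
by rewrite ffunE minEle; case: ifP.
Qed.

Lemma measurable_ratboxE : measurable = <<s range ratbox >> :> set (set 'cV[R]_n).
Proof.
apply/seteqP; split; last first.
  apply: smallest_sub; first exact: sigma_algebra_measurable.
  by move=> _ [q _ <-]; exact: measurable_ratbox.
pose GT := g_sigma_algebraType (range ratbox).
(* A half-space is a union of boxes whose other corners tend to infinity. *)
have mray i q : measurable ([set u : GT | (u : 'cV[R]_n) i 0 <= ratr q]).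
  rewrite (_ : [set _ | _] = \bigcup_k (ratbox [ffun j => if j == i then q else k%:R])).
    apply: bigcupT_measurable => k; apply: sub_sigma_algebra.
    by eexists.
  apply/seteqP; split => [u /= uq|u [k _ h]]; last first.
    by have := h i; rewrite ffunE eqxx.
  have : setT u by []. rewrite -ratbox_cover => -[k _ h]; exists k => // j.
  by rewrite ffunE; case: eqP => [->//|_]; have := h j; rewrite ffunE.
(* The inclusion amounts to measurability of the identity from the generated sigma-algebra, which
   can be tested coordinate by coordinate. *)
suff mid : measurable_fun [set: GT] (fun u : GT => u : 'cV[R]_n).
  by move=> A mA; have := mid measurableT A mA; rewrite setTI.
apply: measurable_fun_mxP => i j; rewrite ord1.
apply: (measurability _ (RGenOInfty.measurableE R)) => _ [_ [x ->] <-].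
(* A coordinate exceeds [x] exactly when it exceeds some rational [q >= x]. *)
rewrite setTI (_ : _ @^-1` _ = \bigcup_(q : rat)
    (if x <= ratr q then ~` [set u : GT | (u : 'cV[R]_n) i 0 <= ratr q] else set0)).
  by apply: bigcupT_measurable_rat => q; case: ifP => // _; exact: measurableC.
apply/seteqP; split => [u /=|u [q _]].
  rewrite in_itv/= andbT => /rat_in_itvoo[q]; rewrite in_itv/= => /andP[xq qu].
  by exists q => //; rewrite (ltW xq) /=; apply/negP; rewrite -ltNge.
case: ifP => // xq /= /negP; rewrite -ltNge in_itv/= andbT; exact: le_lt_trans.
Qed.

Lemma probability_eq_ratbox (p q : probability 'cV[R]_n R) :
  (forall a, p (ratbox a) = q (ratbox a)) ->
  forall U, measurable U -> p U = q U.
Proof.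
move=> pq U mU.
apply: (measure_unique (range ratbox) (fun k => ratbox [ffun=> k%:R])) => //.
- exact: measurable_ratboxE.
- exact: setI_closed_ratbox.
- exact: ratbox_cover.
- by move=> _ [a _ <-]; exact: pq.
- move=> k; rewrite (le_lt_trans (probability_le1 _ _)) ?ltry//.
  exact: measurable_ratbox.
Qed.

End rational_boxes.

(** * The Riccati step *)

Section quadratic_stage.
Context (R : realType).

Lemma qform_mulmx n p (S : 'M[R]_n) (B : 'M[R]_(n, p)) v :
  qform S (B *m v) = qform (B^T *m S *m B) v.
Proof. by rewrite /qform trmx_mul !mulmxA. Qed.

Lemma qform_mulmx_ge0 n p (S : 'M[R]_n) (B : 'M[R]_(n, p)) v :
  posdefmx S -> 0 <= qform (B^T *m S *m B) v.
Proof. by move=> pS; rewrite -qform_mulmx posdefmx_qform_ge0. Qed.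

Lemma sym_mulmx n p (S : 'M[R]_n) (B : 'M[R]_(n, p)) :
  S^T = S -> (B^T *m S *m B)^T = B^T *m S *m B.
Proof. by move=> tS; rewrite !trmx_mul trmxK tS mulmxA. Qed.

Lemma posdefmxDl n (S S' : 'M[R]_n) : posdefmx S -> S'^T = S' ->
  (forall v, 0 <= qform S' v) -> posdefmx (S + S').
Proof.
move=> [tS S0] tS' S'0; split; first by rewrite linearD/= tS tS'.
by move=> v v0; rewrite qformDmx ltr_wpDr ?S0.
Qed.

Lemma qform_complete_square n (M : 'M[R]_n) (b u : 'cV[R]_n) : posdefmx M ->
  qform M u + 2 * (b^T *m u) 0 0 =
  qform M (u + invmx M *m b) - qform (invmx M) b.
Proof.
move=> pM; have uM := posdefmx_unit pM.
rewrite qformD ?(proj1 pM)// -mulmxA mulKVmx//.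
have -> : (u^T *m b) 0 0 = (b^T *m u) 0 0.
  transitivity ((u^T *m b)^T 0 0); first by rewrite [RHS]mxE.
  by rewrite trmx_mul trmxK.
rewrite (qform_mulmx M) trmx_inv (proj1 pM) mulVmx// mul1mx.
by ring.
Qed.

Section stage.
Variables (n m : nat) (A P' : 'M[R]_n) (B : 'M[R]_(n, m)) (Q S : 'M[R]_m) (eps : R).
Hypotheses (eps0 : 0 < eps) (pP' : posdefmx P') (pQ : posdefmx Q) (pS : posdefmx S).
Hypothesis uA : A \in unitmx.

(** With [S] the precision of the prior, [H] is the form in [u] of the input cost plus the next
    value, and [M] adds [eps] times the exponent of the prior. *)
Let H := Q + B^T *m P' *m B.
Let M := H + eps *: S.

Lemma posdefmx_input : posdefmx H.
Proof.
apply: posdefmxDl => //; first exact/sym_mulmx/(proj1 pP').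
by move=> v; exact: qform_mulmx_ge0.
Qed.

Lemma posdefmx_input_prior : posdefmx M.
Proof. by apply: posdefmxD; [exact: posdefmx_input|exact: posdefmxZ]. Qed.

Lemma qform_stage (y : 'cV[R]_n) (u : 'cV[R]_m) :
  qform Q u + qform P' (y + B *m u) =
  qform H u + 2 * ((B^T *m P' *m y)^T *m u) 0 0 + qform P' y.
Proof.
rewrite qformD ?(proj1 pP')// qform_mulmx qformDmx.
rewrite trmx_mul trmx_mul trmxK (proj1 pP') !mulmxA; ring.
Qed.

(** At [y = A x - r'], the square on the right is [eps] times the form in the exponent of the
    Gaussian with mean [mu_Q(x)] and covariance [Sigma_Q]. *)
Lemma qform_stage_input (y : 'cV[R]_n) (u : 'cV[R]_m) :
  qform Q u + qform P' (y + B *m u) =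
  qform H (u + invmx H *m (B^T *m P' *m y)) +
  (qform P' y - qform (invmx H) (B^T *m P' *m y)).
Proof.
rewrite qform_stage qform_complete_square; last exact: posdefmx_input.
by ring.
Qed.

Lemma qform_stage_prior (y : 'cV[R]_n) (u mu : 'cV[R]_m) :
  let b := B^T *m P' *m y - eps *: (S *m mu) in
  qform Q u + qform P' (y + B *m u) + eps * qform S (u - mu) =
  qform M (u + invmx M *m b) +
  (qform P' y + eps * qform S mu - qform (invmx M) b).
Proof.
cbv zeta; set b := B^T *m P' *m y - _.
have := qform_complete_square b u posdefmx_input_prior.
rewrite qform_stage (qformD u (- mu) (proj1 pS)) qformN qformDmx qformZmx.
have -> : (b^T *m u) 0 0 =
    ((B^T *m P' *m y)^T *m u) 0 0 + eps * (u^T *m S *m - mu) 0 0.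
  rewrite /b [(_ - _)^T]linearB/= [(_ *: _)^T]linearZ/= mulmxBl.
  rewrite -scalemxAl.
  rewrite mxE [X in _ + X]mxE [X in _ - X]mxE.
  congr (_ + _); rewrite mulmxN [X in _ = _ * X]mxE mulrN; congr (- (_ * _)).
  transitivity (((S *m mu)^T *m u)^T 0 0); first by rewrite [RHS]mxE.
  by rewrite trmx_mul trmxK mulmxA.
by move=> E; lra.
Qed.

Let P := A^T *m P' *m A -
  A^T *m P' *m B *m invmx M *m B^T *m P' *m A.

Let G := B^T *m P' *m A.

Let PE : P = A^T *m P' *m A - G^T *m invmx M *m G.
Proof.
by rewrite /P /G !trmx_mul trmxK (proj1 pP') !mulmxA.
Qed.

Lemma qform_riccati x : qform P x = qform P' (A *m x) - qform (invmx M) (G *m x).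
Proof.
rewrite !qform_mulmx PE /qform mulmxBr mulmxBl mxE; congr (_ + _).
by rewrite [LHS]mxE.
Qed.

(** For [mu = 0], the form [P] at [x] is the stage cost at its minimiser [u], a sum of nonnegative
    terms. It is positive: through [Q] if [u] is nonzero, and otherwise through [P'] at [A x], which
    is nonzero because [A] is invertible. *)
Lemma posdefmx_riccati : posdefmx P.
Proof.
have pM := posdefmx_input_prior.
split.
  rewrite PE linearB/= !sym_mulmx ?(proj1 pP')//.
  by rewrite trmx_inv (proj1 pM).
move=> x x0; rewrite qform_riccati.
pose u := - (invmx M *m (G *m x)).
have := qform_stage_prior (A *m x) u 0.
cbv zeta; rewrite mulmx0 scaler0 !subr0 qform0 mulr0 addr0.
rewrite mulmxA -/G.
rewrite /u addNr qform0 add0r => <-.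
have Ax0 : A *m x != 0.
  by apply: contra x0 => /eqP Ax; rewrite -(mulKmx uA x) Ax mulmx0.
rewrite -/u; have [->|u0] := eqVneq u 0.
  by rewrite !qform0 mulr0 mulmx0 addr0 add0r addr0 (proj2 pP').
rewrite -addrA ltr_pwDl ?(proj2 pQ)// addr_ge0 ?posdefmx_qform_ge0//.
by rewrite mulr_ge0 ?posdefmx_qform_ge0// ltW.
Qed.

(** Completing the square in [u] leaves a quadratic in [x] whose linear part comes from the mean of
    the prior. A second completion, with [P], moves this part into the centre [r], whence the
    inverse of [P]. *)
Lemma qform_stage_value (r' : 'cV[R]_n) (mu : 'cV[R]_m) :
  let r := invmx A *m r' - eps *: (invmx P *m A^T *m P' *m B *m invmx M *m S *m mu) in
  exists K, forall x u,
    qform Q u + qform P' (A *m x + B *m u - r') + eps * qform S (u - mu) =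
    qform M (u + invmx M *m (B^T *m P' *m (A *m x - r') - eps *: (S *m mu))) +
    (qform P (x - r) + K).
Proof.
move=> r.
have pP := posdefmx_riccati; have uP := posdefmx_unit pP.
have pM := posdefmx_input_prior.
pose c : 'cV[R]_m := - (eps *: (S *m mu)).
pose d := eps *: (invmx P *m A^T *m P' *m B *m invmx M *m S *m mu).
exists (eps * qform S mu - qform (invmx M) c - qform P d) => x u.
pose xi := x - invmx A *m r'.
have yE : A *m x - r' = A *m xi by rewrite /xi mulmxBr mulKVmx.
rewrite (addrAC (A *m x)) qform_stage_prior; congr (_ + _).
rewrite yE mulmxA -/G -/c.
have -> : x - r = xi + d by rewrite /xi /r /d opprB addrA addrAC.
rewrite (qformD _ _ (proj1 pP)) (qformD (G *m xi) c); last first.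
  by rewrite trmx_inv (proj1 pM).
rewrite qform_riccati.
(* The shift [d] is defined so that [P d = - G^T M^-1 c], which matches the cross terms. *)
have -> : ((G *m xi)^T *m invmx M *m c) 0 0 = - (xi^T *m P *m d) 0 0.
  rewrite /c /d mulmxN mxE; congr (- _).
  rewrite -!scalemxAr -!mulmxA (mulmxA P) mulmxV// mul1mx.
  by rewrite /G !trmx_mul trmxK (proj1 pP') !mulmxA.
by ring.
Qed.

End stage.
End quadratic_stage.

(** * Dynamic programming *)

Section dynamic_programming.
Context (R : realType) (n m : nat).
Variables (A : nat -> 'M[R]_n) (B : nat -> 'M[R]_(n, m)).
Variables (mu0 : 'cV[R]_n) (Sigma0 : 'M[R]_n) (Sigmaw : nat -> 'M[R]_n).
Variables (eps : R) (Ru : nat -> 'M[R]_m) (T : nat) (F : 'M[R]_n) (muT : 'cV[R]_n).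
Variable rho : nat -> probability 'cV[R]_m R.
Hypothesis eps_gt0 : 0 < eps.

Local Notation state := (state A B).
Local Notation law := (history_law A B mu0 Sigma0 Sigmaw).

Variable V : nat -> 'cV[R]_n -> R.
Hypotheses (V_ge0 : forall k x, 0 <= V k x)
           (mV : forall k, measurable_fun setT (V k)).

Definition expected_value k (x : 'cV[R]_n) (u : 'cV[R]_m) : \bar R :=
  (\int[gaussian 0 (Sigmaw k)]_w (V k.+1 (A k *m x + B k *m u + w))%:E)%E.

Definition stage_cost k (x : 'cV[R]_n) (u : 'cV[R]_m) : \bar R :=
  ((wnorm (Ru k) u ^+ 2 / 2)%:E + expected_value k x u)%E.

Let expected_value_ge0 k x u : (0 <= expected_value k x u)%E.
Proof. by apply: integral_ge0 => w _; rewrite lee_fin. Qed.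

Let wnorm_ge0 k (u : 'cV[R]_m) : (0 <= (wnorm (Ru k) u ^+ 2 / 2)%:E)%E.
Proof. by rewrite lee_fin divr_ge0// sqr_ge0. Qed.

Let stage_cost_ge0 k x u : (0 <= stage_cost k x u)%E.
Proof. exact: adde_ge0. Qed.

Let measurable_wnorm k :
  measurable_fun setT (fun u : 'cV[R]_m => (wnorm (Ru k) u ^+ 2 / 2)%:E).
Proof.
apply/measurable_EFinP; apply: measurable_funM => //.
rewrite (_ : (fun u => _) = (fun u => Num.max (qform (Ru k) u) 0)).
  by apply: measurable_maxr => //; exact: measurable_qform.
apply/funext => u; rewrite /wnorm; have [q0|q0] := leP 0 (qform (Ru k) u).
  by rewrite sqr_sqrtr.
by rewrite ler0_sqrtr ?ltW// expr0n.
Qed.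

Let measurable_next d (X : measurableType d) k (f : X -> 'cV[R]_n)
    (g : X -> 'cV[R]_m) (w : X -> 'cV[R]_n) :
  measurable_fun setT f -> measurable_fun setT g -> measurable_fun setT w ->
  measurable_fun setT (fun x => (V k.+1 (A k *m f x + B k *m g x + w x))%:E).
Proof.
move=> mf mg mw; apply/measurable_EFinP; apply: measurableT_comp => //.
apply: measurable_addmx => //; apply: measurable_addmx.
- exact: (measurableT_comp (measurable_mulmx _)).
- exact: (measurableT_comp (measurable_mulmx _)).
Qed.

Let measurable_stage_cost k :
  measurable_fun setT (fun z : 'cV[R]_n * 'cV[R]_m => stage_cost k z.1 z.2).
Proof.
apply: emeasurable_funD.
  exact: (measurableT_comp (measurable_wnorm k)).
pose g (p : 'cV[R]_n * 'cV[R]_m * 'cV[R]_n) : \bar R :=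
  (V k.+1 (A k *m p.1.1 + B k *m p.1.2 + p.2))%:E.
apply: (@measurable_fun_fubini_tonelli_F _ _ _ _ _ (gaussian 0 (Sigmaw k)) g).
  apply: measurable_next => //.
  - exact: (measurableT_comp measurable_fst measurable_fst).
  - exact: (measurableT_comp measurable_snd measurable_fst).
by move=> p; rewrite lee_fin.
Qed.

Let measurable_stage_cost_snd k x : measurable_fun setT (stage_cost k x).
Proof. exact: (@measurable_fun_pair2 _ _ _ _ _ _
  (fun z : 'cV[R]_n * 'cV[R]_m => stage_cost k z.1 z.2) x (measurable_stage_cost k)). Qed.

Lemma measurable_expected_stage_cost (pi : @policy R n m) k :
  measurable_fun setT (fun x => \int[pi k x]_u stage_cost k x u)%E.
Proof.
exact: (measurable_fun_integral_sfinite_kernel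
  (fun z : 'cV[R]_n * 'cV[R]_m => stage_cost k z.1 z.2)).
Qed.

Lemma expected_stage_cost_ge0 (pi : @policy R n m) k x :
  (0 <= \int[pi k x]_u stage_cost k x u)%E.
Proof. exact: integral_ge0. Qed.

Section running_sum.
Variables (pi : @policy R n m) (K : nat -> 'cV[R]_n -> \bar R).
Hypotheses (K_ge0 : forall k x, (0 <= K k x)%E)
           (mK : forall k, measurable_fun setT (K k)).

(* [K] stands for the entropic part of the running cost, or for a measurable
   minorant of it. *)
Fixpoint summed_cost k : @history R n m k -> \bar R :=
  if k is k'.+1 then
    fun h => (summed_cost h.1.1 +
      ((wnorm (Ru k') h.1.2 ^+ 2 / 2)%:E + K k' (state h.1.1)))%E
  else fun=> 0%E.

Lemma summed_cost_ge0 k h : (0 <= @summed_cost k h)%E.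
Proof. by elim: k h => //= k ih h; rewrite adde_ge0// adde_ge0. Qed.

Lemma measurable_summed_cost k : measurable_fun setT (@summed_cost k).
Proof.
elim: k => [|k ih] /=; first exact: measurable_cst.
apply: emeasurable_funD.
  exact: (measurableT_comp ih (measurableT_comp measurable_fst measurable_fst)).
apply: emeasurable_funD.
  exact: (measurableT_comp (measurable_wnorm k)
    (measurableT_comp measurable_snd measurable_fst)).
apply: (measurableT_comp (mK k)); apply: (measurableT_comp (@measurable_state R n m A B k)).
exact: (measurableT_comp measurable_fst measurable_fst).
Qed.

(** Expected cost of the first [k] stages with the remaining ones valued by [V]; it interpolates
    between the mean of [V 0] and the total cost. *)
Definition value_at k : \bar R :=
  (\int[law pi k]_h (summed_cost h + (V k (state h))%:E))%E.

(** Tonelli integrates out the noise [w_k], then the input [u_k], leaving the law of the history up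
    to time [k]. *)
Lemma value_atS k : value_at k.+1 =
  (\int[law pi k]_h (summed_cost h +
     (K k (state h) + \int[pi k (state h)]_u stage_cost k (state h) u)))%E.
Proof.
rewrite /value_at.
have mf : measurable_fun setT (fun h : @history R n m k.+1 =>
    (summed_cost h + (V k.+1 (state h))%:E)%E).
  apply: emeasurable_funD; first exact: measurable_summed_cost.
  apply/measurable_EFinP; apply: (measurableT_comp (mV k.+1)).
  exact: measurable_state.
have f0 (h : @history R n m k.+1) :
    (0 <= summed_cost h + (V k.+1 (state h))%:E)%E.
  by apply: adde_ge0; [exact: summed_cost_ge0|rewrite lee_fin].
rewrite [LHS]fubini_tonelli1//.
rewrite integral_semidirect; last 2 first.
- exact: measurable_fun_fubini_tonelli_F.
- by move=> z; apply: integral_ge0.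
apply: eq_integral => h _; rewrite /kernel_comap /=.
have mw := measurable_stage_cost_snd k (state h).
transitivity (\int[pi k (state h)]_u
    ((summed_cost h + K k (state h)) + stage_cost k (state h) u))%E.
  apply: eq_integral => u _; rewrite /fubini_F/=.
  rewrite ge0_integralD//; last 3 first.
  - by move=> w _; rewrite adde_ge0 ?summed_cost_ge0// adde_ge0.
  - by move=> w _; rewrite lee_fin.
  - by apply: measurable_next => //; exact: measurable_cst.
  rewrite integral_cst// [X in (_ * X + _)%E]probability_setT mule1.
  rewrite /stage_cost -/(expected_value k (state h) u).
  by rewrite -!addeA; congr (_ + _)%E; rewrite addeCA.
rewrite ge0_integralD//; last first.
- by move=> u _; rewrite adde_ge0 ?summed_cost_ge0.
by rewrite integral_cst// [X in (_ * X + _)%E]prob_kernel mule1 -addeA.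
Qed.

(** [D] will be the remainder of Gibbs' inequality: a suboptimal stage raises [value_at] by at least
    the mean of [D]. *)
Lemma value_at_le (D : nat -> 'cV[R]_n -> \bar R) k :
  (forall x, (0 <= D k x)%E) -> measurable_fun setT (D k) ->
  (forall x, ((V k x)%:E + D k x <= K k x + \int[pi k x]_u stage_cost k x u)%E) ->
  (value_at k + \int[law pi k]_h D k (state h) <= value_at k.+1)%E.
Proof.
move=> D0 mD le.
have mstate : measurable_fun setT (@Defs.state R n m A B k) by exact: measurable_state.
have macc := @measurable_summed_cost k.
rewrite value_atS /value_at -ge0_integralD//; first last.
- exact: (measurableT_comp mD mstate).
- apply: emeasurable_funD => //; apply/measurable_EFinP.
  exact: (measurableT_comp (mV k) mstate).
- by move=> h _; rewrite adde_ge0 ?summed_cost_ge0// lee_fin.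
apply: nnle_integral => h.
  by rewrite adde_ge0// adde_ge0 ?summed_cost_ge0// lee_fin.
by rewrite -addeA; apply: leeD2l.
Qed.

Lemma value_at0 : value_at 0 = (\int[gaussian mu0 Sigma0]_x (V 0 x)%:E)%E.
Proof. by rewrite /value_at /=; under eq_integral do rewrite add0e. Qed.

End running_sum.

Lemma le_summed_running (pi : @policy R n m) (K : nat -> 'cV[R]_n -> \bar R) :
  (forall k x, (k < T)%N -> (K k x <= eps%:E * kl_div (kernel_at (pi k) x) (rho k))%E) ->
  forall k, (k <= T)%N -> forall h : @history R n m k,
    (summed_cost K h <= running_cost A B eps Ru pi rho h)%E.
Proof.
move=> Kle; elim => // k ih kT h /=.
by apply: leeD; [exact/ih/ltnW|apply: leeD => //; exact: Kle].
Qed.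

Lemma eq_summed_running (pi : @policy R n m) (K : nat -> 'cV[R]_n -> \bar R) :
  (forall k x, (k < T)%N -> (K k x = eps%:E * kl_div (kernel_at (pi k) x) (rho k))%E) ->
  forall k, (k <= T)%N -> forall h : @history R n m k,
    (summed_cost K h = running_cost A B eps Ru pi rho h)%E.
Proof.
move=> KE; elim => // k ih kT h /=.
by rewrite (ih (ltnW kT)) KE.
Qed.

(** * Verification of a candidate policy from Bellman's inequality with remainder *)

Section optimality.
Variable kappa : @policy R n m.
Hypothesis V_terminal : forall x, V T x = wnorm F (x - muT) ^+ 2 / 2.
Hypothesis kappa_le : forall k x (p : probability 'cV[R]_m R) U,
  (k < T)%N -> measurable U ->
  ((V k x + eps * ((fine (p U) - fine (kappa k x U)) ^+ 2 / 2))%:E <=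
   \int[p]_u stage_cost k x u + eps%:E * kl_div p (rho k))%E.
Hypothesis kappa_eq : forall k x, (k < T)%N ->
  (\int[kappa k x]_u stage_cost k x u +
   eps%:E * kl_div (kernel_at (kappa k) x) (rho k) = (V k x)%:E)%E.

Local Notation J pi := (cost A B mu0 Sigma0 Sigmaw eps Ru T F muT pi rho).

Let scaled_kl_ge0 (pi : @policy R n m) k x : (0 <= eps%:E * kl_div (kernel_at (pi k) x) (rho k))%E.
Proof. by apply: mule_ge0; [rewrite lee_fin ltW|exact: kl_div_ge0]. Qed.

Lemma cost_optimal : J kappa = (\int[gaussian mu0 Sigma0]_x (V 0 x)%:E)%E.
Proof.
pose K k x : \bar R := (if (k < T)%N then
  eps%:E * kl_div (kernel_at (kappa k) x) (rho k) else 0)%E.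
have K0 k x : (0 <= K k x)%E by rewrite /K; case: ifP.
have mK k : measurable_fun setT (K k).
  rewrite /K; case: (boolP (k < T)%N) => kT; last exact: measurable_cst.
  (* By [kappa_eq] the entropic term is a difference of measurable functions; the subtracted one is
     finite. *)
  rewrite (_ : (fun x => _) =
      fun x => ((V k x)%:E - \int[kappa k x]_u stage_cost k x u)%E).
    apply: emeasurable_funB; first exact/measurable_EFinP.
    exact: measurable_expected_stage_cost.
  apply/funext => x; rewrite -(kappa_eq x kT) addeAC subee ?add0e//.
  have : ((\int[kappa k x]_u stage_cost k x u) < +oo)%E.
    rewrite (@le_lt_trans _ _ (V k x)%:E) ?ltry// -(kappa_eq x kT).
    by rewrite leeDl.
  by rewrite ge0_fin_numE// expected_stage_cost_ge0.
have valueE k : (k <= T)%N -> value_at kappa K k =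
    (\int[gaussian mu0 Sigma0]_x (V 0 x)%:E)%E.
  elim: k => [|k ih] kT; first exact: value_at0.
  rewrite -(ih (ltnW kT)) value_atS//; apply: eq_integral => h _.
  congr (_ + _)%E; rewrite -(kappa_eq _ kT) addeC; congr (_ + _)%E.
  by rewrite /K kT.
rewrite -(valueE T)// /cost /value_at; apply: eq_integral => h _.
rewrite V_terminal (@eq_summed_running kappa)// => k x kT.
by rewrite /K kT.
Qed.

(** [K] is the part of the entropic cost forced by Gibbs' inequality: [V + D - G] cut off at 0, with
    [G] the expected stage cost. Then [value_at] increases from the mean of [V 0] to at most the
    cost of [pi], and stage [k] contributes the mean of [D]. *)
Lemma cost_lower_bound (pi : @policy R n m) k U : (k < T)%N -> measurable U ->
  (\int[gaussian mu0 Sigma0]_x (V 0 x)%:E +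
   \int[law pi k]_h (eps * ((fine (pi k (state h) U) -
     fine (kappa k (state h) U)) ^+ 2 / 2))%:E <= J pi)%E.
Proof.
move=> kT mU.
pose D j x : \bar R := (eps * ((fine (pi j x U) - fine (kappa j x U)) ^+ 2 / 2))%:E.
have D0 j x : (0 <= D j x)%E.
  by rewrite lee_fin; apply: mulr_ge0; [exact: ltW|rewrite divr_ge0// sqr_ge0].
have mD j : measurable_fun setT (D j).
  apply/measurable_EFinP; apply: measurable_funM => //; apply: measurable_funM => //.
  apply: measurable_funX; apply: measurable_funB;
    by apply: measurableT_comp; [exact: fine_measurable|exact: measurable_kernel].
pose G j x := (\int[pi j x]_u stage_cost j x u)%E.
pose K j x : \bar R := (if (j < T)%N then maxe 0 ((V j x)%:E + D j x - G j x) else 0)%E.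
have K0 j x : (0 <= K j x)%E.
  by rewrite /K; case: ifP => // _; rewrite le_max lexx.
have mK j : measurable_fun setT (K j).
  rewrite /K; case: (boolP (j < T)%N) => jT; last exact: measurable_cst.
  apply: measurable_maxe => //; apply: emeasurable_funB.
    by apply: emeasurable_funD => //; exact/measurable_EFinP.
  exact: measurable_expected_stage_cost.
have G0 j x : (0 <= G j x)%E by exact: expected_stage_cost_ge0.
have VDK j x : (j < T)%N -> ((V j x)%:E + D j x <= K j x + G j x)%E.
  move=> jT; rewrite /K jT.
  (* If [G] is infinite then [V + D - G] is [-oo] and [K] is 0, but the right-hand side is [+oo]. *)
  have [Goo|] := ltP (G j x) +oo%E; last first.
    rewrite leye_eq => /eqP ->.
    by rewrite addey ?leey// gt_eqF// (lt_le_trans _ (K0 j x)).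
  rewrite -leeBlDr; last by rewrite ge0_fin_numE.
  by rewrite le_max lexx orbT.
have step j : (j < T)%N ->
    (value_at pi K j + \int[law pi j]_h D j (state h) <= value_at pi K j.+1)%E.
  by move=> jT; apply: value_at_le => // x; exact: VDK.
have mono i j : (i <= j)%N -> (j <= T)%N -> (value_at pi K i <= value_at pi K j)%E.
  elim: j => [|j ih]; first by rewrite leqn0 => /eqP ->.
  rewrite leq_eqVlt => /predU1P[->//|ij jT].
  apply: (le_trans (ih ij (ltnW jT))); apply: le_trans (step j jT).
  by rewrite leeDl// integral_ge0.
apply: (@le_trans _ _ (value_at pi K T)); last first.
  rewrite /value_at /cost; apply: nnle_integral => h.
    by rewrite adde_ge0 ?summed_cost_ge0// lee_fin.
  rewrite V_terminal; apply: leeD => //.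
  apply: le_summed_running => // j x jT; rewrite /K jT ge_max scaled_kl_ge0/=.
  have := kappa_le x (kernel_at (pi j) x) jT mU.
  rewrite EFinD -/(D j x) -[X in (_ <= X + _)%E]/(G j x) => le1.
  have [Goo|] := ltP (G j x) +oo%E; last first.
    by rewrite leye_eq => /eqP ->; rewrite addeNy leNye.
  by rewrite leeBlDr ?ge0_fin_numE// [leRHS]addeC.
apply: le_trans (mono _ _ kT (leqnn T)); apply: le_trans (step k kT).
by apply: leeD => //; rewrite -(value_at0 pi K); exact: mono _ _ (leq0n k) (ltnW kT).
Qed.

Hypothesis V0_fin : (\int[gaussian mu0 Sigma0]_x (V 0 x)%:E < +oo)%E.

Lemma verified_policy_optimal : (0 < T)%N ->
  optimal_policy A B mu0 Sigma0 Sigmaw eps Ru T F muT rho kappa.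
Proof.
move=> T0 pi; rewrite cost_optimal.
(* The remainder is only needed to be nonnegative here, so stage 0 and the empty set serve. *)
apply: le_trans (cost_lower_bound pi T0 measurable0).
rewrite leeDl//; apply: integral_ge0 => h _.
by rewrite lee_fin; apply: mulr_ge0; [exact: ltW|rewrite divr_ge0// sqr_ge0].
Qed.

(** Optimality bounds the cost of [pi] by that of [kappa], which is the finite mean of [V 0];
    cancelling it forces the mean remainder to vanish. *)
Lemma optimal_policy_ae_unique pi : optimal_policy A B mu0 Sigma0 Sigmaw eps Ru T F muT rho pi ->
  forall k U, (k < T)%N -> measurable U ->
  {ae law pi k, forall h, pi k (state h) U = kappa k (state h) U}.
Proof.
move=> opt k U kT mU.
pose D (h : @history R n m k) : \bar R := (eps * ((fine (pi k (state h) U) -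
     fine (kappa k (state h) U)) ^+ 2 / 2))%:E.
have D0 h : (0 <= D h)%E.
  by rewrite lee_fin; apply: mulr_ge0; [exact: ltW|rewrite divr_ge0// sqr_ge0].
have mD : measurable_fun setT D.
  apply/measurable_EFinP; apply: measurable_funM => //; apply: measurable_funM => //.
  apply: measurable_funX; apply: measurable_funB;
    (apply: measurableT_comp; first exact: fine_measurable);
    apply: (measurableT_comp (measurable_kernel _ _ mU));
    exact: measurable_state.
have iD : (\int[law pi k]_h D h = 0)%E.
  apply/eqP; rewrite eq_le integral_ge0// andbT.
  have V0 : (0 <= \int[gaussian mu0 Sigma0]_x (V 0 x)%:E)%E.
    by apply: integral_ge0 => x _; rewrite lee_fin.
  have := le_trans (cost_lower_bound pi kT mU) (opt kappa).
  rewrite cost_optimal -[X in (_ <= X)%E]adde0.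
  by rewrite leeD2lE// ge0_fin_numE.
have /(ae_eq_integral_abs _ measurableT mD) : (\int[law pi k]_h `|D h| = 0)%E.
  by rewrite -iD; apply: eq_integral => h _; rewrite gee0_abs.
apply: filterS => h /(_ I) [] /eqP.
rewrite mulf_eq0 gt_eqF//= mulf_eq0 invr_eq0 pnatr_eq0 orbF sqrf_eq0 subr_eq0 => /eqP.
have pfin : pi k (state h) U \is a fin_num.
  exact: (fin_num_measure (kernel_at (pi k) (state h))).
have kfin : kappa k (state h) U \is a fin_num.
  exact: (fin_num_measure (kernel_at (kappa k) (state h))).
by move=> e; rewrite -(fineK pfin) -(fineK kfin) e.
Qed.

End optimality.
End dynamic_programming.

(** * Lebesgue measure is dominated by the law of each state *)

Section state_law.
Context (R : realType) (n m : nat).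
Variables (A : nat -> 'M[R]_n) (B : nat -> 'M[R]_(n, m)).
Variables (mu0 : 'cV[R]_n) (Sigma0 : 'M[R]_n) (Sigmaw : nat -> 'M[R]_n).

(** For a positive time, almost every section of the event over the past and the input is null for
    the noise, so at least one is. That section is a translate of [N]. *)
Lemma state_null (pi : @policy R n m) k N : measurable N ->
  history_law A B mu0 Sigma0 Sigmaw pi k (@state R n m A B k @^-1` N) = 0%E ->
  lebesgue_cV n N = 0%E.
Proof.
case: k => [|k] mN /=; first exact: gaussian_null.
set E := (_ @^-1` N) => E0.
have mE : measurable E.
  rewrite -[X in measurable X]setTI.
  exact: (@measurable_state R n m A B k.+1 measurableT N mN).
set P := semidirect _ _ in E0.
have mg : measurable_fun setT (fun x => gaussian 0 (Sigmaw k) (xsection E x)).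
  exact: measurable_fun_xsection.
have : (\int[P]_x `|gaussian 0 (Sigmaw k) (xsection E x)| = 0)%E.
  by rewrite -[RHS]E0; apply: eq_integral => x _; rewrite gee0_abs.
move/(ae_eq_integral_abs _ measurableT mg) => [M [mM M0 EM]].
have [x Ex0] : exists x, gaussian 0 (Sigmaw k) (xsection E x) = 0%E.
  apply: contrapT => /forallNP nE.
  have : P setT = 0%E.
    apply/eqP; rewrite eq_le measure_ge0 andbT -M0 le_measure ?inE// => x _.
    by apply: EM => /= /(_ I); exact: nE.
  by have -> : P setT = 1%E by [exact: probability_setT]; move=> /eqP; rewrite eqe oner_eq0.
have mEx : measurable (xsection E x) by exact: measurable_xsection.
rewrite -(lebesgue_cV_translate (A k *m state A B x.1 + B k *m x.2) mN).
rewrite -[RHS](gaussian_null mEx Ex0); congr (lebesgue_cV n _).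
by apply/seteqP; split => w; rewrite /xsection /= inE.
Qed.

End state_law.

(** * The optimal policy of one stage *)

Section gaussian_stage.
Context (R : realType).

Lemma gaussian_pdf_posdef n (Sigma : 'M[R]_n) : posdefmx Sigma ->
  exists2 N : R, 0 < N & forall mu u,
    gaussian_pdf mu Sigma u = expR (- qform (invmx Sigma) (u - mu) / 2) / N.
Proof.
move=> pS; exists (Num.sqrt ((2 * pi) ^+ n * \det Sigma)).
  have [dS _] := integral_expR_qform 0 pS.
  by rewrite sqrtr_gt0 mulr_gt0// exprn_gt0// mulr_gt0// pi_gt0.
by move=> mu u; rewrite /gaussian_pdf asboolT.
Qed.

Lemma gaussian_change_density n (mu mu' : 'cV[R]_n) (Sigma Sigma' : 'M[R]_n)
    (psi : 'cV[R]_n -> R) : measurable_fun setT psi ->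
  (forall u, gaussian_pdf mu' Sigma' u = expR (psi u) * gaussian_pdf mu Sigma u) ->
  forall U, measurable U ->
  (gaussian mu' Sigma' U = \int[gaussian mu Sigma]_(u in U) (expR (psi u))%:E)%E.
Proof.
move=> mpsi pdfE U mU; rewrite [RHS]integral_mkcond integral_gaussian; last 2 first.
- apply/(measurable_restrictT _ mU); apply/measurable_EFinP.
  by apply: measurable_funTS; exact: measurableT_comp.
- by apply: erestrict_ge0 => u _; rewrite lee_fin expR_ge0.
rewrite /gaussian integral_mkcond; apply: eq_integral => u _.
rewrite !patchE; case: ifPn => _; last by rewrite mul0e.
by rewrite pdfE EFinM.
Qed.

(** Factors [Sigma] out on the left, which turns the inverse in the offset recursion into the
    inverse of [M] produced by completing the square. *)
Lemma invmx_input_prior n (H Sigma : 'M[R]_n) (eps : R) :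
  posdefmx Sigma -> posdefmx (H + eps *: invmx Sigma) ->
  invmx (Sigma *m H + eps%:M) = invmx (H + eps *: invmx Sigma) *m invmx Sigma.
Proof.
move=> pS pM; have uS := posdefmx_unit pS; have uM := posdefmx_unit pM.
have -> : Sigma *m H + eps%:M = Sigma *m (H + eps *: invmx Sigma).
  by rewrite mulmxDr -scalemxAr mulmxV// scalemx1.
set M := H + _ in uM *.
have E : Sigma *m M *m (invmx M *m invmx Sigma) = 1%:M.
  by rewrite mulmxA mulmxK// mulmxV.
have u : Sigma *m M \in unitmx by rewrite unitmx_mul uS.
by rewrite -[LHS]mulmx1 -E mulKmx.
Qed.

Variables (n m : nat) (A P' : 'M[R]_n) (B : 'M[R]_(n, m)) (Q Sr : 'M[R]_m).
Variables (eps : R) (r' : 'cV[R]_n) (mu : 'cV[R]_m).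
Hypotheses (eps0 : 0 < eps) (pP' : posdefmx P') (pQ : posdefmx Q) (pSr : posdefmx Sr).
Hypothesis uA : A \in unitmx.

Let H := Q + B^T *m P' *m B.
Let M := H + eps *: invmx Sr.
Let P := A^T *m P' *m A - A^T *m P' *m B *m invmx M *m B^T *m P' *m A.
Let r := invmx A *m r' - eps *: (invmx P *m A^T *m P' *m B *m
  invmx (Sr *m H + eps%:M) *m mu).

(** Mean of the normalised product of the prior with the Gaussian of mean [mu_Q(x)] and covariance
    [Sigma_Q], read off from [qform_stage_prior]. *)
Definition posterior_mean (x : 'cV[R]_n) : 'cV[R]_m :=
  - (invmx M *m (B^T *m P' *m (A *m x - r') - eps *: (invmx Sr *m mu))).

Definition posterior_cov : 'M[R]_m := eps *: invmx M.

Lemma measurable_posterior_mean : measurable_fun setT posterior_mean.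
Proof.
rewrite (_ : posterior_mean = fun x => - (invmx M *m B^T *m P' *m A) *m x +
    invmx M *m (B^T *m P' *m r' + eps *: (invmx Sr *m mu))).
  apply: measurable_addmx; last exact: measurable_cst.
  exact: measurable_mulmx.
apply/funext => x; rewrite /posterior_mean !(mulmxDr, mulmxN, mulNmx) !mulmxA.
by rewrite !opprD !opprK addrA.
Qed.

Let pM : posdefmx M.
Proof. by apply: posdefmx_input_prior => //; exact: posdefmx_inv. Qed.

Let pH : posdefmx H. Proof. exact: posdefmx_input. Qed.

Lemma posdefmx_posterior_cov : posdefmx posterior_cov.
Proof. by apply: posdefmxZ => //; exact: posdefmx_inv. Qed.

Let invmx_scaled (X : 'M[R]_m) : posdefmx X -> invmx (eps *: invmx X) = eps^-1 *: X.
Proof.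
move=> pX; rewrite invmxZ ?invmxK//.
by apply: posdefmx_unit; apply: posdefmxZ => //; exact: posdefmx_inv.
Qed.

Lemma posterior_pdf_cost : exists K, forall c' x u,
  gaussian_pdf (posterior_mean x) posterior_cov u =
  expR ((qform P (x - r) / 2 + (c' + K) -
     (qform Q u / 2 + (qform P' (A *m x + B *m u - r') / 2 + c'))) / eps) *
  gaussian_pdf mu Sr u.
Proof.
have [N1 N10 pdf1] := gaussian_pdf_posdef posdefmx_posterior_cov.
have [N2 N20 pdf2] := gaussian_pdf_posdef pSr.
have [K0 KE] := qform_stage_value B eps0 pP' pQ (posdefmx_inv pSr) uA r' mu.
exists (K0 / 2 + eps * ln (N2 / N1)) => c' x u.
have {}KE := KE x u.
rewrite pdf1 pdf2 /posterior_cov invmx_scaled// qformZmx /posterior_mean opprK.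
have rE : x - r = x - (invmx A *m r' - eps *: (invmx P *m A^T *m P' *m B *m
    invmx M *m invmx Sr *m mu)).
  by rewrite /r invmx_input_prior// !mulmxA.
rewrite rE.
move: KE; rewrite -/H -/M -/P.
set q := qform M _; set v := qform P _; set q1 := qform Q _; set q2 := qform P' _.
set q3 := qform (invmx Sr) _ => KE.
have e0 : eps != 0 by rewrite gt_eqF.
have -> : (v / 2 + (c' + (K0 / 2 + eps * ln (N2 / N1))) - (q1 / 2 + (q2 / 2 + c'))) / eps =
    - (eps^-1 * q) / 2 + q3 / 2 + ln (N2 / N1).
  have -> : v = q1 + q2 + eps * q3 - q - K0 by rewrite KE; ring.
  by field.
rewrite !expRD lnK ?posrE ?divr_gt0// mulNr expRN.
rewrite [- q3 / 2]mulNr expRN.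
have := expR_gt0 (q3 / 2); have := expR_gt0 (eps^-1 * q / 2).
set a := expR _; set b := expR _ => a0 b0.
by field; rewrite !gt_eqF.
Qed.

(** The same cost is completed to a square with and without the prior; the two exponents differ by
    [s] and [t], which do not involve [u]. *)
Lemma posterior_pdf_propto x : exists2 c : R, 0 < c & forall u,
  gaussian_pdf (posterior_mean x) posterior_cov u =
  c * (gaussian_pdf mu Sr u * gaussian_pdf
    (- (invmx H *m B^T *m P' *m A *m (x - invmx A *m r'))) (eps *: invmx H) u).
Proof.
have [N1 N10 pdf1] := gaussian_pdf_posdef posdefmx_posterior_cov.
have [N2 N20 pdf2] := gaussian_pdf_posdef pSr.
have pcH : posdefmx (eps *: invmx H) by apply: posdefmxZ => //; exact: posdefmx_inv.
have [N3 N30 pdf3] := gaussian_pdf_posdef pcH.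
have [K0 KE] := qform_stage_value B eps0 pP' pQ (posdefmx_inv pSr) uA r' mu.
pose y := A *m x - r'.
pose s := qform P' y - qform (invmx H) (B^T *m P' *m y).
pose t := qform P (x - (invmx A *m r' - eps *: (invmx P *m A^T *m P' *m B *m
  invmx M *m invmx Sr *m mu))) + K0.
exists (expR ((t - s) / eps / 2) * (N2 * N3 / N1)) => [|u].
  by rewrite mulr_gt0 ?expR_gt0// divr_gt0// mulr_gt0.
have {}KE := KE x u.
rewrite pdf1 pdf2 pdf3 /posterior_cov !invmx_scaled// !qformZmx /posterior_mean !opprK.
have -> : invmx H *m B^T *m P' *m A *m (x - invmx A *m r') = invmx H *m (B^T *m P' *m y).
  by rewrite /y -!mulmxA mulmxBr mulKVmx.
have := qform_stage_input B pP' pQ y u; rewrite -/H -/s.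
have -> : y + B *m u = A *m x + B *m u - r' by rewrite /y addrAC.
move: KE; rewrite -/H -/M -/P -/y -/t.
set q := qform M _; set q1 := qform Q _; set q2 := qform P' _.
set q3 := qform (invmx Sr) _; set q4 := qform H _ => KE1 KE2.
have e0 : eps != 0 by rewrite gt_eqF.
have -> : - (eps^-1 * q) / 2 = (t - s) / eps / 2 + (- q3 / 2 + - (eps^-1 * q4) / 2).
  have -> : q = q4 + s + eps * q3 - t by rewrite -KE2 KE1; ring.
  by field.
rewrite !expRD; field.
by rewrite !gt_eqF.
Qed.

(** The equality is stated for every [p] with the values of [q] on measurable sets, so that it
    applies to the policy kernel at [x], which is a different term from [q]. *)
Lemma gaussian_stage_gibbs (Sw : 'M[R]_n) (c' : R) : 0 <= c' ->
  exists2 c : R, 0 <= c & forall x,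
    let stage u := ((wnorm Q u ^+ 2 / 2)%:E + \int[gaussian 0 Sw]_w
      (qform P' (A *m x + B *m u + w - r') / 2 + c')%:E)%E in
    let v := qform P (x - r) / 2 + c in
    let q : probability 'cV[R]_m R := gaussian (posterior_mean x) posterior_cov in
    let rho : probability 'cV[R]_m R := gaussian mu Sr in
    (forall (p : probability 'cV[R]_m R) U, measurable U ->
      ((v + eps * ((fine (p U) - fine (q U)) ^+ 2 / 2))%:E <=
       \int[p]_u stage u + eps%:E * kl_div p rho)%E) /\
    (forall p : probability 'cV[R]_m R, (forall U, measurable U -> p U = q U) ->
      (\int[p]_u stage u + eps%:E * kl_div p rho = v%:E)%E).
Proof.
move=> c'0.
have [Mw Mw0 MwE] := gaussian0_qform_shift Sw pP'.
have [K KE] := posterior_pdf_cost.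
(* Averaging over the noise shifts the next value function by [Mw / 2]. *)
pose d' := Mw / 2 + c'.
have d'0 : 0 <= d' by rewrite addr_ge0 ?divr_ge0.
pose cst x u := qform Q u / 2 + (qform P' (A *m x + B *m u - r') / 2 + d').
have cst0 x u : 0 <= cst x u.
  by rewrite !addr_ge0 ?divr_ge0 ?posdefmx_qform_ge0.
have mcst x : measurable_fun setT (cst x).
  apply: measurable_funD; first by apply: measurable_funM => //; exact: measurable_qform.
  apply: measurable_funD => //; apply: measurable_funM => //.
  apply: measurableT_comp; first exact: measurable_qform.
  apply: measurable_addmx; last exact: measurable_cst.
  by apply: measurable_addmx; [exact: measurable_cst|exact: measurable_mulmx].
have stageE x u : ((wnorm Q u ^+ 2 / 2)%:E + \int[gaussian 0 Sw]_w
      (qform P' (A *m x + B *m u + w - r') / 2 + c')%:E = (cst x u)%:E)%E.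
  rewrite /wnorm sqr_sqrtr ?posdefmx_qform_ge0//.
  under eq_integral => w _ do rewrite (addrAC _ w) mulrC EFinD EFinM.
  have mq : measurable_fun setT
      (fun w : 'cV[R]_n => (qform P' (A *m x + B *m u - r' + w))%:E).
    by apply/measurable_EFinP; exact: measurable_qform_add.
  have q0 w : (0 <= (qform P' (A *m x + B *m u - r' + w))%:E)%E.
    by rewrite lee_fin posdefmx_qform_ge0.
  rewrite ge0_integralD//; last 2 first.
  - by move=> w _; rewrite mule_ge0.
  - exact: measurable_funeM.
  rewrite ge0_integralZl// MwE integral_cst//.
  rewrite [X in (_ + (_ + _ * X))%E]probability_setT mule1 -EFinM -!EFinD.
  by congr EFin; rewrite /cst /d'; ring.
have qE x (q : probability 'cV[R]_m R) :
    (forall U, measurable U -> q U = gaussian (posterior_mean x) posterior_cov U) ->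
    forall U, measurable U -> (q U = \int[gaussian mu Sr]_(u in U)
      (expR ((qform P (x - r) / 2 + (d' + K) - cst x u) / eps))%:E)%E.
  move=> qG U mU; rewrite qG//; apply: gaussian_change_density => //.
  by apply: measurable_funM => //; exact: measurable_funB.
(* At [x = r] the quadratic part of the minimum vanishes, so [gibbs_ge0] there gives the sign of the
   constant. *)
exists (d' + K).
  have := gibbs_ge0 eps0 (cst0 r) (mcst r) (qE r _ (fun _ _ => erefl)).
  by rewrite subrr qform0 mul0r add0r.
move=> x stage v q rho.
have stE (p : probability 'cV[R]_m R) : (\int[p]_u stage u = \int[p]_u (cst x u)%:E)%E.
  by apply: eq_integral => u _; rewrite /stage stageE.
split=> [p U mU|p pq]; rewrite stE.
  exact: (gibbs_le eps0 (cst0 x) (mcst x) (qE x q (fun _ _ => erefl)) p mU).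
exact: (gibbs_eq eps0 (cst0 x) (mcst x) (qE x p pq)).
Qed.

End gaussian_stage.

(** * Backward recursion and assembly of the theorem *)

Lemma backward_choice (X : Type) (x0 : X) (rel : nat -> X -> X -> Prop) T :
  (forall k x, (k < T)%N -> exists y, rel k x y) ->
  exists2 c : nat -> X, c T = x0 & forall k, (k < T)%N -> rel k (c k.+1) (c k).
Proof.
elim: T => [|T ih] in x0 *; first by exists (fun=> x0).
(* The last step is taken first; the induction hypothesis treats the shorter horizon that ends at
   [y]. *)
move=> relT; have [y x0y] := relT T x0 (ltnSn T).
have [k x kT|c cT cr] := ih y; first by apply: relT; exact: ltnW.
exists (fun k => if k == T.+1 then x0 else c k); first by rewrite eqxx.
move=> k; rewrite ltnS eqSS leq_eqVlt => /predU1P[->|kT].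
  by rewrite eqxx cT ltn_eqF.
by rewrite (ltn_eqF kT) (ltn_eqF (leqW kT)); exact: cr.
Qed.

Lemma backward_ind (P : nat -> Prop) T : P T ->
  (forall k, (k < T)%N -> P k.+1 -> P k) -> forall k, (k <= T)%N -> P k.
Proof.
move=> PT PS k kT; rewrite -(subKn kT); elim: (T - k)%N => [|j ih].
  by rewrite subn0.
by rewrite subnS; case: (T - j)%N (leq_subr j T) ih => [|i] //= iT; exact: PS.
Qed.

Theorem theorem4 (R : realType) (n m T : nat) (eps : R)
    (mu_ini mu_fin : 'cV[R]_n) (Sigma_ini F : 'M[R]_n)
    (A : nat -> 'M[R]_n) (B : nat -> 'M[R]_(n, m))
    (Ru : nat -> 'M[R]_m) (Sigma_w : nat -> 'M[R]_n)
    (mu_rho : nat -> 'cV[R]_m) (Sigma_rho : nat -> 'M[R]_m)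
    (n_gt0 : (0 < n)%N) (m_gt0 : (0 < m)%N) (T_gt0 : (0 < T)%N)
    (eps_gt0 : 0 < eps)
    (F_posdef : posdefmx F) (Sigma_ini_posdef : posdefmx Sigma_ini)
    (Ru_posdef : forall k, (k < T)%N -> posdefmx (Ru k))
    (Sigma_w_posdef : forall k, (k < T)%N -> posdefmx (Sigma_w k))
    (Sigma_rho_posdef : forall k, (k < T)%N -> posdefmx (Sigma_rho k))
    (A_unit : forall k, (k < T)%N -> A k \in unitmx) :
  let rho : nat -> probability 'cV[R]_m R :=
    fun k => gaussian (mu_rho k) (Sigma_rho k) in
  let is_riccati := riccati A B eps Ru T F Sigma_rho in
  let is_optimal :=
    optimal_policy A B mu_ini Sigma_ini Sigma_w eps Ru T F mu_fin rho in
  [/\ exists Pi, is_riccati Pi,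
      forall Pi Pi', is_riccati Pi -> is_riccati Pi' ->
        forall k, (k <= T)%N -> Pi k = Pi' k &
      forall Pi r, is_riccati Pi ->
        offset_recursion A B eps Ru T mu_fin mu_rho Sigma_rho Pi r ->
        (forall k, (k <= T)%N -> posdefmx (Pi k)) /\
        exists pi_rho : policy n m,
          [/\ forall k, (k < T)%N -> forall x : 'cV[R]_n,
                density_propto (pi_rho k x)
                  (fun u => gaussian_pdf (mu_rho k) (Sigma_rho k) u *
                     gaussian_pdf (mean_Q A B Ru Pi r k x)
                                  (cov_Q B eps Ru Pi k) u),
              is_optimal pi_rho &
              forall pi : policy n m, is_optimal pi -> eq_policy T pi pi_rho]].
Proof.
move=> rho is_riccati is_optimal; split.
- pose step k (P P' : 'M[R]_n) := P' = (A k)^T *m P *m A k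
    - (A k)^T *m P *m B k
      *m invmx (Ru k + (B k)^T *m P *m B k + eps *: invmx (Sigma_rho k))
      *m (B k)^T *m P *m A k.
  have [//|Pi PiT PiS] := @backward_choice _ F step T; last by exists Pi.
  by move=> k P _; eexists.
- move=> Pi Pi' [PiT PiS] [Pi'T Pi'S]; apply: backward_ind.
    by rewrite PiT Pi'T.
  by move=> k kT E; rewrite PiS// Pi'S// E.
move=> Pi r [PiT PiS] [rT rS].
have pPi : forall k, (k <= T)%N -> posdefmx (Pi k).
  apply: backward_ind => [|k kT pP]; first by rewrite PiT.
  rewrite PiS//; apply: posdefmx_riccati => //; first exact: Ru_posdef.
    exact/posdefmx_inv/Sigma_rho_posdef.
  exact: A_unit.
split=> //.
pose mean k x := posterior_mean (A k) (Pi k.+1) (B k) (Ru k) (Sigma_rho k) eps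
  (r k.+1) (mu_rho k) x.
pose cov k := posterior_cov (Pi k.+1) (B k) (Ru k) (Sigma_rho k) eps.
have mmean k : measurable_fun setT (mean k) by exact: measurable_posterior_mean.
pose pi_rho : policy n m := fun k => gaussian_kernel (mfun_Sub (mem_set (mmean k))) (cov k).
have pi_rhoE k x U : pi_rho k x U = gaussian (mean k x) (cov k) U by [].
(* The additive constants are known only to exist. The premise [0 <= c'] inside the relation makes
   it total; the signs are recovered afterwards by backward induction from [c T = 0]. *)
have [|c cT cS] := @backward_choice R 0 (fun k c' c => 0 <= c' -> 0 <= c /\ forall x,
    let stage u := ((wnorm (Ru k) u ^+ 2 / 2)%:E + \int[gaussian 0 (Sigma_w k)]_w
      (qform (Pi k.+1) (A k *m x + B k *m u + w - r k.+1) / 2 + c')%:E)%E in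
    let v := qform (Pi k) (x - r k) / 2 + c in
    let q : probability 'cV[R]_m R := gaussian (mean k x) (cov k) in
    (forall (p : probability 'cV[R]_m R) U, measurable U ->
      ((v + eps * ((fine (p U) - fine (q U)) ^+ 2 / 2))%:E <=
       \int[p]_u stage u + eps%:E * kl_div p (rho k))%E) /\
    (forall p : probability 'cV[R]_m R, (forall U, measurable U -> p U = q U) ->
      (\int[p]_u stage u + eps%:E * kl_div p (rho k) = v%:E)%E)) T.
  move=> k c' kT; have [c'0|/negP nc'] := boolP (0 <= c'); last by exists 0 => c'0; case: nc'.
  have [c c0] := gaussian_stage_gibbs (B k) (r k.+1) (mu_rho k) eps_gt0
    (pPi k.+1 kT) (Ru_posdef k kT) (Sigma_rho_posdef k kT) (A_unit k kT)
    (Sigma_w k) c'0.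
  by rewrite -(PiS k kT) -(rS k kT) => cE; exists c.
have c0 : forall k, (k <= T)%N -> 0 <= c k.
  apply: backward_ind => [|k kT ck]; first by rewrite cT.
  by have [] := cS k kT ck.
(* Beyond the horizon nothing is known about [Pi] and [r]. *)
pose V k x := if (k <= T)%N then qform (Pi k) (x - r k) / 2 + c k else 0.
have V0 k x : 0 <= V k x.
  rewrite /V; case: ifP => // kT.
  by rewrite addr_ge0 ?c0// divr_ge0// posdefmx_qform_ge0//; exact: pPi.
have mV k : measurable_fun setT (V k).
  rewrite /V; case: (boolP (k <= T)%N) => _; last exact: measurable_cst.
  by apply: measurable_funD => //; apply: measurable_funM => //; exact: measurable_qform_sub.
have VT x : V T x = wnorm F (x - mu_fin) ^+ 2 / 2.
  rewrite /V leqnn cT addr0 PiT rT /wnorm sqr_sqrtr//.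
  exact: posdefmx_qform_ge0.
have le_pi k x (p : probability 'cV[R]_m R) U : (k < T)%N -> measurable U ->
    ((V k x + eps * ((fine (p U) - fine (pi_rho k x U)) ^+ 2 / 2))%:E <=
     \int[p]_u stage_cost A B Sigma_w Ru V k x u + eps%:E * kl_div p (rho k))%E.
  move=> kT mU.
  have [_ /(_ x)[+ _]] := cS k kT (c0 _ kT).
  by move=> /(_ p U mU); rewrite /stage_cost /expected_value /V kT ltnW.
have eq_pi k x : (k < T)%N ->
    (\int[pi_rho k x]_u stage_cost A B Sigma_w Ru V k x u +
     eps%:E * kl_div (kernel_at (pi_rho k) x) (rho k) = (V k x)%:E)%E.
  move=> kT.
  have [_ /(_ x)[_]] := cS k kT (c0 _ kT).
  move=> /(_ (kernel_at (pi_rho k) x) (fun _ _ => erefl)).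
  by rewrite /stage_cost /expected_value /V kT ltnW.
have V0fin : (\int[gaussian mu_ini Sigma_ini]_x (V 0 x)%:E < +oo)%E.
  apply: (@le_lt_trans _ _ (\int[gaussian mu_ini Sigma_ini]_x
      ((qform (Pi 0%N) (x - r 0%N))%:E + (c 0%N)%:E))%E).
    apply: nnle_integral => x; first by rewrite lee_fin.
    rewrite /V leq0n -EFinD lee_fin lerD2r ler_piMr ?invf_le1 ?ler1n//.
    exact/posdefmx_qform_ge0/pPi.
  rewrite ge0_integralD//; last 3 first.
  - by move=> x _; rewrite lee_fin; exact/posdefmx_qform_ge0/pPi.
  - by apply/measurable_EFinP; exact: measurable_qform_sub.
  - by move=> x _; rewrite lee_fin c0.
  rewrite integral_cst// [X in (_ + _ * X)%E]probability_setT mule1.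
  by rewrite lte_add_pinfty ?ltry//; apply: gaussian_qform_lty; exact: pPi.
exists pi_rho; split.
- move=> k kT x.
  have [c' c'0 pdfE] := posterior_pdf_propto (B k) (r k.+1) (mu_rho k) eps_gt0
    (pPi k.+1 kT) (Ru_posdef k kT) (Sigma_rho_posdef k kT) (A_unit k kT) x.
  by exists c' => // U mU; rewrite pi_rhoE; apply: eq_integral => u _; rewrite pdfE.
- by move=> pi; apply: (verified_policy_optimal mu_ini Sigma_ini eps_gt0 V0 mV VT le_pi eq_pi T_gt0).
move=> pi opt k kT.
(* The exceptional set is null for the state under [pi] itself, hence Lebesgue-null by
   [state_null]. *)
have aeU U : measurable U -> {ae lebesgue_cV n, forall x, pi k x U = pi_rho k x U}.
  move=> mU; pose N := [set x | pi k x U != pi_rho k x U].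
  have mN : measurable N.
    by rewrite -[X in measurable X]setTI; apply: measurable_neqe => //;
      exact: measurable_kernel.
  exists N; split => //; last by move=> x /= /eqP.
  apply: (state_null (pi := pi) (k := k) mN).
  have := optimal_policy_ae_unique eps_gt0 V0 mV VT le_pi eq_pi V0fin opt kT mU.
  move=> [M [mM M0 NM]]; apply/eqP; rewrite eq_le measure_ge0 andbT -M0.
  have mSN : measurable (@state R n m A B k @^-1` N).
    rewrite -[X in measurable X]setTI.
    exact: (@measurable_state R n m A B k measurableT N mN).
  apply: le_measure; [exact: mem_set|exact: mem_set|].
  by move=> h /= /eqP hN; exact: NM.
(* Enumerating the corners by [unpickle] yields one null set for all boxes. *)
have : {ae lebesgue_cV n, forall x, forall i : nat,
    if unpickle i is Some a then pi k x (@ratbox R m a) = pi_rho k x (ratbox a) else True}.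
  apply: ae_foralln => i; case: (unpickle i) => [a|]; last by apply: aeW.
  by apply: aeU; exact: measurable_ratbox.
apply: filterS => x xE U mU.
apply: (probability_eq_ratbox (p := kernel_at (pi k) x) (q := kernel_at (pi_rho k) x)) => // a.
by have := xE (pickle a); rewrite pickleK.
Qed.
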